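(* Let $d\ge 2$ and $D\ge 1$ be integers, let $G=(V,E)$ be a $D$-regular graph with $n=|V|$ vertices, identified with $[n]$, and let $\rho=\rho^{Q_1\cdots Q_n}$ be a quantum state on $n$ qudits $Q_1,\ldots,Q_n$, each of dimension $d$ (i.e. a density matrix on $(\mathbb{C}^d)^{\otimes n}$). Then there exists a globally separable state $\sigma$ on $(\mathbb{C}^d)^{\otimes n}$ such that $$\mathbb{E}_{(i,j)\in E}\,\big\|\rho^{Q_iQ_j}-\sigma^{Q_iQ_j}\big\|_1\le 12\left(\frac{d^2\ln(d)}{D}\right)^{1/3}.$$
   Context: A quantum state (density matrix) is a positive semidefinite matrix of unit trace. For a state $\rho$ on $Q_1\cdots Q_n$, $\rho^{Q_iQ_j}$ denotes its reduced state (partial trace over all systems other than $Q_i,Q_j$). $\|X\|_1=\operatorname{tr}\sqrt{X^\dagger X}$ is the trace norm. A state $\sigma$ is globally separable if $\sigma=\sum_z p_z\,\sigma_z^{Q_1}\otimes\cdots\otimes\sigma_z^{Q_n}$ for a probability distribution $(p_z)$ and single-qudit states $\sigma_z^{Q_i}$. $\mathbb{E}_{(i,j)\in E}$ denotes the average over a uniformly random edge of $G$. *)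

(* Defs.v *)
From mathcomp Require Import all_boot all_order all_algebra.
From mathcomp Require Import complex.
From mathcomp Require Import all_classical all_reals exp.

Set Implicit Arguments.
Unset Strict Implicit.
Unset Printing Implicit Defensive.

Import Order.TTheory GRing.Theory Num.Theory.
Local Open Scope ring_scope.

Definition adjmx {C : numClosedFieldType} m n (A : 'M[C]_(m, n)) : 'M[C]_(n, m) :=
  (map_mx Num.conj A)^T.

Definition psdmx {C : numClosedFieldType} n (A : 'M[C]_n) : Prop :=
  A = adjmx A /\ forall v : 'rV[C]_n, 0 <= (v *m A *m adjmx v) 0 0.

Definition density {C : numClosedFieldType} n (A : 'M[C]_n) : Prop :=
  psdmx A /\ \tr A = 1.

(* matrix square root via the spectral decomposition A = P^-1 diag(l) P
   (spectralmx / spectral_diag from mathcomp's spectral.v); for a PSD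
   (hence normal) A this is the unique PSD square root of A. *)
Definition sqrtmx {C : numClosedFieldType} n (A : 'M[C]_n) : 'M[C]_n :=
  invmx (spectralmx A) *m diag_mx (map_mx sqrtC (spectral_diag A)) *m spectralmx A.

Definition trnorm {R : realType} n (X : 'M[R[i]]_n) : R :=
  complex.Re (\tr (sqrtmx (adjmx X *m X))).

Definition ent {C : Type} (T : finType) (A : 'M[C]_#|T|) (x y : T) : C :=
  A (enum_rank x) (enum_rank y).

Definition mkop {C : Type} (T : finType) (f : T -> T -> C) : 'M[C]_#|T| :=
  \matrix_(p, q) f (enum_val p) (enum_val q).

(* computational basis of n qudits of dimension d: strings x : [n] -> [d] *)
Definition qbasis (n d : nat) : finType := {ffun 'I_n -> 'I_d}.

Definition qop (C : Type) (n d : nat) := 'M[C]_#|qbasis n d|.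

Definition qop2 (C : Type) (d : nat) := 'M[C]_#|{: 'I_d * 'I_d}|.

Definition ptrace2 {C : numClosedFieldType} (n d : nat) (i j : 'I_n)
    (rho : qop C n d) : qop2 C d :=
  mkop (fun (ab ab' : 'I_d * 'I_d) =>
    \sum_(x : qbasis n d | (x i == ab.1) && (x j == ab.2))
      \sum_(y : qbasis n d | [&& y i == ab'.1, y j == ab'.2 &
                                [forall k, (k != i) && (k != j) ==> (x k == y k)]])
        ent rho x y).

Definition tensorn {C : numClosedFieldType} (n d : nat) (s : 'I_n -> 'M[C]_d)
    : qop C n d :=
  mkop (fun x y : qbasis n d => \prod_(k < n) s k (x k) (y k)).

Definition separable {R : realType} (n d : nat) (sigma : qop R[i] n d) : Prop :=
  exists (m : nat) (p : 'I_m -> R) (s : 'I_m -> 'I_n -> 'M[R[i]]_d),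
    [/\ forall z, 0 <= p z,
        \sum_(z < m) p z = 1,
        forall z k, density (s z k) &
        sigma = \sum_(z < m) (p z)%:C%C *: tensorn (s z)].

Definition regular_graph (n D : nat) (e : rel 'I_n) : Prop :=
  [/\ symmetric e, irreflexive e & forall v, #|[set w | e v w]| = D].

(* average over a uniformly random edge (i,j) of f i j; ordered pairs
   (i,j) with e i j are used, each undirected edge contributing both
   orientations -- there are n*D of them. *)
Definition edge_avg {R : realType} (n D : nat) (e : rel 'I_n)
    (f : 'I_n -> 'I_n -> R) : R :=
  (\sum_(i < n) \sum_(j < n | e i j) f i j) / (n * D)%:R.

(* Main.v *)
Require Import Defs.
From mathcomp Require Import all_boot all_order all_algebra.
From mathcomp Require Import complex.
From mathcomp Require Import all_classical all_reals exp.
From mathcomp Require Import ring lra.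
Import Order.TTheory GRing.Theory Num.Theory.
Local Open Scope ring_scope.
Set Implicit Arguments.
Unset Strict Implicit.
Unset Printing Implicit Defensive.

(* Measure a few qudits and replace the rest by the product of their conditional
   marginals. The potential is the sum, over the unmeasured qudits i, of the
   expected purity of the state of i conditioned on the outcomes, plus one for
   each measured qudit; it never exceeds n. If xi is the correlation
   R_ij - A_i (x) B_j of two unmeasured qudits, a rank-one measurement of j whose
   directions are a discrete analogue of Gaussian vectors raises the expected
   purity of i by at least |xi|_2^2 / 4, with no loss in d: Cauchy-Schwarz
   reduces this to a second and a third moment of v -> <v|xi|v>. Measuring
   greedily any qudit that raises the potential by more than 1/x stops after at
   most n x measurements, and then |xi|_2^2 averages to O(1/(x D)) over the
   edges. As |xi|_1 <= d |xi|_2 and edges meeting a measured qudit cost at most 2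
   each, x = (d^2 ln d / D)^(1/3) gives the bound. *)

(** * A discrete analogue of Gaussian vectors *)

Section EntryAverages.
Context {C : numClosedFieldType}.

Lemma amgm2 (a b : C) : a * b^* + a^* * b <= `|a| ^+ 2 + `|b| ^+ 2.
Proof.
rewrite -subr_ge0 !normCK.
have -> : a * a^* + b * b^* - (a * b^* + a^* * b) = (a - b) * (a - b)^*.
  by ring.
exact: mul_conjC_ge0.
Qed.

Lemma normD_sqr_le (a b : C) : `|a + b| ^+ 2 <= 2 * `|a| ^+ 2 + 2 * `|b| ^+ 2.
Proof.
have -> : `|a + b| ^+ 2 = `|a| ^+ 2 + `|b| ^+ 2 + (a * b^* + a^* * b).
  by rewrite !normCK; ring.
have -> : 2 * `|a| ^+ 2 + 2 * `|b| ^+ 2 =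
  `|a| ^+ 2 + `|b| ^+ 2 + (`|a| ^+ 2 + `|b| ^+ 2) by ring.
by rewrite lerD2l amgm2.
Qed.

(** With the weights [zwt], the law of one coordinate: 0 with probability 1/2 and each of the four
    points +-1 +- i with probability 1/8. Like a standard complex Gaussian, z has E z = E z^2 = 0, E
    |z|^2 = 1 and E |z|^4 = 2. *)
Definition zpt (k : 'I_5) : C :=
  nth 0 [:: 0; 1 + 'i; 1 - 'i; - 1 + 'i; - 1 - 'i] k.

Definition zwt (k : 'I_5) : C := if k == ord0 then 2^-1 else 8^-1.

Lemma zwt_ge0 k : 0 <= zwt k.
Proof. by rewrite /zwt; case: ifP => _; rewrite invr_ge0 ler0n. Qed.

(** The integrand takes z and its conjugate as separate arguments, so that a moment becomes a
    polynomial identity that [ring] decides with i^2 = -1. *)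
Lemma zpt_avg (h : C -> C -> C) :
  8 * \sum_k zwt k * h (zpt k) (zpt k)^* =
  4 * h 0 0 + h (1 + 'i) (1 - 'i) + h (1 - 'i) (1 + 'i)
  + h (- 1 + 'i) (- 1 - 'i) + h (- 1 - 'i) (- 1 + 'i).
Proof.
rewrite !big_ord_recl big_ord0 /zwt /zpt /=.
rewrite !(rmorphD, rmorphN, rmorph1, rmorph0) /= !conjCi !opprK.
have h8 : (8 : C) != 0 by rewrite pnatr_eq0.
have h2 : (2 : C) != 0 by rewrite pnatr_eq0.
by field.
Qed.

Lemma zpt_avgP (h : C -> C -> C) (r : C) :
  4 * h 0 0 + h (1 + 'i) (1 - 'i) + h (1 - 'i) (1 + 'i)
  + h (- 1 + 'i) (- 1 - 'i) + h (- 1 - 'i) (- 1 + 'i) = 8 * r ->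
  \sum_k zwt k * h (zpt k) (zpt k)^* = r.
Proof.
by rewrite -zpt_avg => /mulfI; apply; rewrite pnatr_eq0.
Qed.

Lemma zpt_mean : \sum_k zwt k * zpt k = 0.
Proof. by apply: (@zpt_avgP (fun z _ => z)); ring. Qed.

Lemma zpt_conj_mean : \sum_k zwt k * (zpt k)^* = 0.
Proof. by apply: (@zpt_avgP (fun _ z => z)); ring. Qed.

Lemma zpt_var : \sum_k zwt k * (zpt k * (zpt k)^*) = 1.
Proof. by apply: (@zpt_avgP (fun z z' => z * z')); ring: (sqrCi C). Qed.

Lemma zwt_sum : \sum_k zwt k = 1.
Proof.
rewrite -[RHS](@zpt_avgP (fun _ _ => 1) 1); last by ring.
by apply: eq_bigr => k _; rewrite mulr1.
Qed.

Lemma zpt_avg_lin2 (L s : C) :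
  \sum_k zwt k * `|L + (zpt k)^* * s| ^+ 2 = `|L| ^+ 2 + `|s| ^+ 2.
Proof.
under eq_bigr do rewrite normCK !(rmorphD, rmorphM) /= ?conjCK.
apply: (@zpt_avgP (fun z z' => (L + z' * s) * (L^* + z * s^*))).
by rewrite !normCK; ring: (sqrCi C).
Qed.

(** The cross terms combine into |P s + L t|^2, the only part of the exact average that needs an
    estimate. *)
Lemma zpt_avg_lin4 (L s P t : C) :
  \sum_k zwt k * (`|P + (zpt k)^* * t| ^+ 2 * `|L + (zpt k)^* * s| ^+ 2)
  <= `|P| ^+ 2 * `|L| ^+ 2 + 2 * (`|P| ^+ 2 * `|s| ^+ 2)
     + 2 * (`|L| ^+ 2 * `|t| ^+ 2) + 2 * (`|t| ^+ 2 * `|s| ^+ 2).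
Proof.
have -> : \sum_k zwt k * (`|P + (zpt k)^* * t| ^+ 2 * `|L + (zpt k)^* * s| ^+ 2)
  = `|P| ^+ 2 * `|L| ^+ 2 + `|P * s + L * t| ^+ 2
    + 2 * (`|t| ^+ 2 * `|s| ^+ 2).
  under eq_bigr do rewrite !normCK !(rmorphD, rmorphM) /= ?conjCK.
  apply: (@zpt_avgP (fun z z' => (P + z' * t) * (P^* + z * t^*) *
    ((L + z' * s) * (L^* + z * s^*)))).
  by rewrite !normCK !(rmorphD, rmorphM); ring: (sqrCi C).
rewrite lerD2r -addrA lerD2l (le_trans (normD_sqr_le _ _)) //.
by rewrite !normrM !exprMn.
Qed.

(** The functions 1, z, conj z and |z|^2 - 1 are orthonormal for the five-point law; the last one
    has norm one because E |z|^4 = 2. *)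
Lemma zpt_avg_quad2 (F P Q y : C) :
  \sum_k zwt k * `|F + zpt k * P + (zpt k)^* * Q
                   + (zpt k * (zpt k)^* - 1) * y| ^+ 2
  = `|F| ^+ 2 + `|P| ^+ 2 + `|Q| ^+ 2 + `|y| ^+ 2.
Proof.
under eq_bigr do
  rewrite normCK !(rmorphD, rmorphN, rmorphM, rmorph1) /= ?conjCK.
apply: (@zpt_avgP (fun z z' => (F + z * P + z' * Q + (z * z' - 1) * y) *
  (F^* + z' * P^* + z * Q^* + (z' * z - 1) * y^*))).
by rewrite !normCK; ring: (sqrCi C).
Qed.

(* The phases z^k, -2 <= k <= 1, are uncorrelated, so only the products within
   one power of z survive; these are then estimated by [amgm2]. *)
Lemma zpt_avg_quad4 (F P Q y L s : C) :
  \sum_k zwt k * (`|F + zpt k * P + (zpt k)^* * Q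
                    + (zpt k * (zpt k)^* - 1) * y| ^+ 2
                  * `|L + (zpt k)^* * s| ^+ 2)
  <= `|F| ^+ 2 * `|L| ^+ 2 + 4 * (`|F| ^+ 2 * `|s| ^+ 2)
     + 2 * (`|P| ^+ 2 * `|L| ^+ 2) + 2 * (`|Q| ^+ 2 * `|L| ^+ 2)
     + 3 * (`|P| ^+ 2 * `|s| ^+ 2) + 3 * (`|Q| ^+ 2 * `|s| ^+ 2)
     + 3 * (`|y| ^+ 2 * `|L| ^+ 2) + 2 * (`|y| ^+ 2 * `|s| ^+ 2).
Proof.
pose cr (a b : C) := a * b^* + a^* * b.
have -> : \sum_k zwt k * (`|F + zpt k * P + (zpt k)^* * Q
                    + (zpt k * (zpt k)^* - 1) * y| ^+ 2
                  * `|L + (zpt k)^* * s| ^+ 2) =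
  `|F| ^+ 2 * `|L| ^+ 2 + 2 * (`|P| ^+ 2 * `|s| ^+ 2)
  + `|y| ^+ 2 * `|L| ^+ 2 + `|P| ^+ 2 * `|L| ^+ 2
  + `|y| ^+ 2 * `|s| ^+ 2 + 2 * (`|Q| ^+ 2 * `|s| ^+ 2)
  + (cr (F * s^*) (P * L^*) + cr (P * s) (y * L) + cr (Q * s^*) (y * L^*)
     + cr (F * s) (y * s) + `|Q * L + F * s| ^+ 2).
  under eq_bigr do
    rewrite !normCK !(rmorphD, rmorphN, rmorphM, rmorph1) /= ?conjCK.
  apply: (@zpt_avgP (fun z z' => (F + z * P + z' * Q + (z * z' - 1) * y) *
    (F^* + z' * P^* + z * Q^* + (z' * z - 1) * y^*) *
    ((L + z' * s) * (L^* + z * s^*)))).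
  by rewrite /cr !normCK !(rmorphD, rmorphM) /= !conjCK; ring: (sqrCi C).
have crs (a b : C) : cr a b <= `|a| ^+ 2 + `|b| ^+ 2 := amgm2 a b.
apply: le_trans (lerD (lexx _) (lerD (lerD (lerD (lerD (crs _ _) (crs _ _))
  (crs _ _)) (crs _ _)) (normD_sqr_le _ _))) _.
rewrite !normrM !norm_conjC !exprMn le_eqVlt; apply/orP; left; apply/eqP.
by ring.
Qed.

End EntryAverages.

(** * Vectors built coordinate by coordinate, and moments of their forms *)

Section Design.
Context {C : numClosedFieldType}.

Definition antilin d (u v : 'I_d -> C) : C := \sum_a u a * (v a)^*.

(** The quadratic form of Y centred by its mean: the trace is its average over vectors with identity
    covariance. *)
Definition cquad d (Y : 'I_d -> 'I_d -> C) (v : 'I_d -> C) : C :=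
  \sum_a \sum_b Y a b * (v a * (v b)^*) - \sum_a Y a a.

Definition nrm1 d (u : 'I_d -> C) : C := \sum_a `|u a| ^+ 2.

Definition nrm2 d (Y : 'I_d -> 'I_d -> C) : C := \sum_a \sum_b `|Y a b| ^+ 2.

Definition vcons d (z : C) (v : 'I_d -> C) (i : 'I_d.+1) : C :=
  if unlift ord0 i is Some j then v j else z.

Lemma vcons0 d z (v : 'I_d -> C) : vcons z v ord0 = z.
Proof. by rewrite /vcons unlift_none. Qed.

Lemma vconsS d z (v : 'I_d -> C) j : vcons z v (lift ord0 j) = v j.
Proof. by rewrite /vcons liftK. Qed.

Lemma antilin_cons d (u : 'I_d.+1 -> C) z (v : 'I_d -> C) :
  antilin u (vcons z v) = antilin (u \o lift ord0) v + z^* * u ord0.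
Proof.
rewrite /antilin big_ord_recl vcons0 addrC mulrC; congr (_ + _).
by apply: eq_bigr => j _; rewrite vconsS.
Qed.

Definition minor00 d (Y : 'I_d.+1 -> 'I_d.+1 -> C) (a b : 'I_d) :=
  Y (lift ord0 a) (lift ord0 b).
Definition row0 d (Y : 'I_d.+1 -> 'I_d.+1 -> C) (b : 'I_d) :=
  Y ord0 (lift ord0 b).
Definition col0 d (Y : 'I_d.+1 -> 'I_d.+1 -> C) (a : 'I_d) :=
  (Y (lift ord0 a) ord0)^*.

Lemma cquad_cons d (Y : 'I_d.+1 -> 'I_d.+1 -> C) z (v : 'I_d -> C) :
  cquad Y (vcons z v) = cquad (minor00 Y) v + z * antilin (row0 Y) v
    + z^* * (antilin (col0 Y) v)^* + (z * z^* - 1) * Y ord0 ord0.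
Proof.
rewrite /cquad /antilin.
rewrite big_ord_recl [\sum_(b < d.+1) Y ord0 b * _]big_ord_recl.
rewrite [in X in _ - X]big_ord_recl.
under [X in _ + X - _ = _]eq_bigr do rewrite big_ord_recl vcons0 vconsS.
rewrite big_split /= !vcons0 rmorph_sum /= !mulr_sumr.
under [\sum_(i < d) Y ord0 (lift ord0 i) * _]eq_bigr do rewrite vconsS.
under [X in _ + (_ + X) - _ = _]eq_bigr do under eq_bigr do rewrite vconsS.
rewrite [\sum_(i < d) Y (lift ord0 i) ord0 * _](_ : _ =
   \sum_(i < d) z^* * (col0 Y i * (v i)^*)^*); last first.
  apply: eq_bigr => i _; rewrite /col0 rmorphM /= !conjCK; ring.
rewrite [\sum_(i < d) Y ord0 (lift ord0 i) * _](_ : _ =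
   \sum_(i < d) z * (row0 Y i * (v i)^*)); last first.
  by apply: eq_bigr => i _; rewrite /row0; ring.
rewrite /minor00; ring.
Qed.

Lemma nrm1_recl d (u : 'I_d.+1 -> C) :
  nrm1 u = nrm1 (u \o lift ord0) + `|u ord0| ^+ 2.
Proof. by rewrite /nrm1 big_ord_recl addrC. Qed.

Lemma nrm2_recl d (Y : 'I_d.+1 -> 'I_d.+1 -> C) :
  nrm2 Y = nrm2 (minor00 Y) + nrm1 (row0 Y) + nrm1 (col0 Y)
           + `|Y ord0 ord0| ^+ 2.
Proof.
rewrite /nrm2 /nrm1 big_ord_recl big_ord_recl.
under [X in _ + _ + X = _]eq_bigr do rewrite big_ord_recl.
rewrite big_split /=.
under [\sum_(i < d) `|col0 Y i| ^+ 2]eq_bigr do rewrite /col0 norm_conjC.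
rewrite /minor00 /row0; ring.
Qed.

Lemma nrm1_ge0 d (u : 'I_d -> C) : 0 <= nrm1 u.
Proof. by apply: sumr_ge0 => a _; rewrite exprn_ge0. Qed.

Lemma nrm2_ge0 d (Y : 'I_d -> 'I_d -> C) : 0 <= nrm2 Y.
Proof. by apply: sumr_ge0 => a _; apply: nrm1_ge0. Qed.

(* A finite substitute for a Gaussian random vector: [cquad] is isometric and
   the weight |<u, v>|^2 distorts its second moment by a bounded factor,
   uniformly in the dimension. *)
Record design d (W : finType) (w : W -> C) (v : W -> 'I_d -> C) : Prop :=
  Design {
    design_ge0 : forall o, 0 <= w o;
    design_pov : forall a b, \sum_o w o * (v o a * (v o b)^*) = (a == b)%:R;
    design_lin2 : forall u, \sum_o w o * `|antilin u (v o)| ^+ 2 = nrm1 u;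
    design_lin4 : forall u c,
      \sum_o w o * (`|antilin c (v o)| ^+ 2 * `|antilin u (v o)| ^+ 2)
      <= 2 * (nrm1 c * nrm1 u);
    design_quad2 : forall Y, \sum_o w o * `|cquad Y (v o)| ^+ 2 = nrm2 Y;
    design_quad4 : forall Y u,
      \sum_o w o * (`|cquad Y (v o)| ^+ 2 * `|antilin u (v o)| ^+ 2)
      <= 4 * (nrm2 Y * nrm1 u)
  }.

Lemma design_zero :
  design (fun _ : unit => 1 : C) (fun (_ : unit) (_ : 'I_0) => 0).
Proof.
split=> //.
- by case.
- by move=> u; rewrite big_const cardT enumT unlock /= mul1r /antilin /nrm1
    !big_ord0 normr0 expr0n addr0.
- move=> u c; rewrite big_const cardT enumT unlock /= mul1r /antilin /nrm1.
  by rewrite !big_ord0 normr0 expr0n /= mul0r mulr0 addr0.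
- move=> Y; rewrite big_const cardT enumT unlock /= mul1r /cquad /nrm2.
  by rewrite !big_ord0 subr0 normr0 expr0n addr0.
- move=> Y u; rewrite big_const cardT enumT unlock /= mul1r /antilin /cquad.
  by rewrite /nrm2 /nrm1 !big_ord0 subr0 normr0 expr0n /= mul0r mulr0 addr0.
Qed.

Lemma pair_avg (A B : finType) (w : A -> C) (wz : B -> C) (F : A -> B -> C) :
  \sum_(o : A * B) w o.1 * wz o.2 * F o.1 o.2 =
  \sum_o w o * \sum_k wz k * F o k.
Proof.
rewrite -(pair_bigA _ (fun o k => w o * wz k * F o k)) /=.
by apply: eq_bigr => o _; rewrite mulr_sumr; apply: eq_bigr => k _; rewrite mulrA.
Qed.

Lemma ler_wsum (A : finType) (w F G : A -> C) :
  (forall o, 0 <= w o) -> (forall o, F o <= G o) ->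
  \sum_o w o * F o <= \sum_o w o * G o.
Proof. by move=> w0 FG; apply: ler_sum => o _; apply: ler_wpM2l. Qed.

Lemma wsumD (A : finType) (w F G : A -> C) :
  \sum_o w o * (F o + G o) = \sum_o w o * F o + \sum_o w o * G o.
Proof. by rewrite -big_split; apply: eq_bigr => o _; rewrite mulrDr. Qed.

Lemma wsumZ (A : finType) (w F : A -> C) c :
  \sum_o w o * (c * F o) = c * \sum_o w o * F o.
Proof. by rewrite mulr_sumr; apply: eq_bigr => o _; rewrite mulrCA. Qed.

Lemma wsumZr (A : finType) (w F : A -> C) c :
  \sum_o w o * (F o * c) = (\sum_o w o * F o) * c.
Proof. by rewrite mulr_suml; apply: eq_bigr => o _; rewrite mulrA. Qed.

Section Step.
Variables (d : nat) (W : finType) (w : W -> C) (v : W -> 'I_d -> C).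
Hypothesis dsg : design w v.

Let w' (o : W * 'I_5) := w o.1 * zwt o.2.
Let v' (o : W * 'I_5) := vcons (zpt o.2) (v o.1).

Lemma design_sum1 : \sum_o w o = 1 -> \sum_o w' o = 1.
Proof.
move=> w1; under eq_bigr do rewrite /w' -[_ * _]mulr1.
rewrite (pair_avg w zwt (fun _ _ => 1)).
under eq_bigr => o _ do under eq_bigr do rewrite mulr1.
by under eq_bigr do rewrite zwt_sum mulr1.
Qed.

(** An independent coordinate z turns [antilin] and [cquad] into polynomials in z whose coefficients
    are forms in the shorter vector. Averaging over z first leaves moments that the hypothesis on
    the shorter vector controls, with the same constants 2 and 4. *)
Lemma designS : \sum_o w o = 1 -> design w' v'.
Proof.
move=> w1; have w0 := design_ge0 dsg.
have wc c : \sum_o w o * c = c by rewrite -mulr_suml w1 mul1r.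
split.
- by move=> [o k]; rewrite mulr_ge0 ?zwt_ge0.
- move=> a b.
  rewrite (pair_avg w zwt (fun o k =>
    vcons (zpt k) (v o) a * (vcons (zpt k) (v o) b)^*)).
  case: (unliftP ord0 a) => [a'|] ->; case: (unliftP ord0 b) => [b'|] ->.
  + under eq_bigr do under eq_bigr do rewrite !vconsS.
    under eq_bigr do rewrite -mulr_suml zwt_sum mul1r.
    by rewrite (design_pov dsg) (inj_eq lift_inj).
  + under eq_bigr do under eq_bigr do rewrite vconsS vcons0 mulrCA.
    under eq_bigr do rewrite -mulr_sumr zpt_conj_mean !mulr0.
    by rewrite sumr_const mul0rn eq_sym (negbTE (neq_lift _ _)).
  + under eq_bigr do under eq_bigr do rewrite vconsS vcons0 mulrA.
    under eq_bigr do rewrite -mulr_suml zpt_mean mul0r mulr0.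
    by rewrite sumr_const mul0rn (negbTE (neq_lift _ _)).
  + under eq_bigr do under eq_bigr do rewrite !vcons0.
    under eq_bigr do rewrite zpt_var mulr1.
    by rewrite w1 eqxx.
- move=> u; rewrite (pair_avg w zwt (fun o k =>
    `|antilin u (vcons (zpt k) (v o))| ^+ 2)).
  under eq_bigr do under eq_bigr do rewrite antilin_cons.
  under eq_bigr do rewrite zpt_avg_lin2.
  by rewrite wsumD (design_lin2 dsg) wc -nrm1_recl.
- move=> u c; rewrite (pair_avg w zwt (fun o k =>
    `|antilin c (vcons (zpt k) (v o))| ^+ 2
    * `|antilin u (vcons (zpt k) (v o))| ^+ 2)).
  under eq_bigr do under eq_bigr do rewrite !antilin_cons.
  apply: le_trans (ler_wsum w0 (fun o => zpt_avg_lin4 _ _ _ _)) _.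
  rewrite !wsumD wc !wsumZ !wsumZr !(design_lin2 dsg).
  rewrite (nrm1_recl u) (nrm1_recl c).
  set c' := _ \o _; set u' := _ \o _.
  apply: le_trans (lerD (lerD (lerD (design_lin4 dsg _ _) (lexx _)) (lexx _))
    (lexx _)) _.
  rewrite le_eqVlt; apply/orP; left; apply/eqP; ring.
- move=> Y; rewrite (pair_avg w zwt (fun o k =>
    `|cquad Y (vcons (zpt k) (v o))| ^+ 2)).
  under eq_bigr do under eq_bigr do rewrite cquad_cons.
  under eq_bigr do rewrite zpt_avg_quad2 norm_conjC.
  rewrite !wsumD (design_quad2 dsg) !(design_lin2 dsg) wc.
  by rewrite nrm2_recl.
- move=> Y u; rewrite (pair_avg w zwt (fun o k =>
    `|cquad Y (vcons (zpt k) (v o))| ^+ 2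
    * `|antilin u (vcons (zpt k) (v o))| ^+ 2)).
  under eq_bigr do under eq_bigr do rewrite cquad_cons antilin_cons.
  apply: le_trans (ler_wsum w0 (fun o => zpt_avg_quad4 _ _ _ _ _ _)) _.
  under eq_bigr do rewrite norm_conjC.
  rewrite !wsumD wc !wsumZ !wsumZr !(design_lin2 dsg) !(design_quad2 dsg).
  rewrite (nrm2_recl Y) (nrm1_recl u).
  set Y' := minor00 Y; set p := row0 Y; set q := col0 Y; set u' := _ \o _.
  set y := `|Y _ _| ^+ 2; set s := `|u _| ^+ 2.
  (* The factor 2 on |P|^2 |L|^2 and |Q|^2 |L|^2, times the 2 of [design_lin4], uses up the constant
     4 exactly. *)
  have le2 (r t : C) (h : r <= t) : 2 * r <= 2 * t by rewrite ler_wpM2l.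
  have B1 := design_quad4 dsg Y' u'.
  have B2 := le2 _ _ (design_lin4 dsg u' p).
  have B3 := le2 _ _ (design_lin4 dsg u' q).
  apply: le_trans (lerD (lerD (lerD (lerD (lerD (lerD (lerD B1 (lexx _)) B2) B3)
    (lexx _)) (lexx _)) (lexx _)) (lexx _)) _.
  rewrite -subr_ge0.
  have y0 : 0 <= y by rewrite exprn_ge0.
  have s0 : 0 <= s by rewrite exprn_ge0.
  rewrite [X in 0 <= X](_ : _ = nrm1 p * s + nrm1 q * s + y * nrm1 u'
     + 2 * (y * s)); last by ring.
  by rewrite !addr_ge0 ?mulr_ge0 ?nrm1_ge0.
Qed.

End Step.

Lemma design_exists d : exists (W : finType) (w : W -> C) (v : W -> 'I_d -> C),
  design w v.
Proof.
(* Total weight one is carried along: it makes constants average to themselves in [designS]. *)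
suff: exists (W : finType) (w : W -> C) (v : W -> 'I_d -> C),
    design w v /\ \sum_o w o = 1.
  by move=> [W [w [v [dsg _]]]]; exists W, w, v.
elim: d => [|d [W [w [v [dsg w1]]]]].
  exists unit, (fun=> 1), (fun _ _ => 0); split; first exact: design_zero.
  by rewrite big_const cardT enumT unlock /= addr0.
exists (W * 'I_5)%type, (fun o => w o.1 * zwt o.2),
  (fun o => vcons (zpt o.2) (v o.1)); split; first exact: designS.
exact: design_sum1.
Qed.

End Design.

(** * Positive semidefinite kernels *)

Section PSD.
Context {C : numClosedFieldType}.

Lemma adjmxE m n (A : 'M[C]_(m, n)) i j : adjmx A i j = (A j i)^*.
Proof. by rewrite !mxE. Qed.

Lemma adjmxM m n p (A : 'M[C]_(m, n)) (B : 'M[C]_(n, p)) :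
  adjmx (A *m B) = adjmx B *m adjmx A.
Proof. by rewrite /adjmx map_mxM trmx_mul. Qed.

Lemma adjmxK m n (A : 'M[C]_(m, n)) : adjmx (adjmx A) = A.
Proof. by apply/matrixP => i j; rewrite !adjmxE conjCK. Qed.

Lemma adjmxD m n (A B : 'M[C]_(m, n)) : adjmx (A + B) = adjmx A + adjmx B.
Proof. by apply/matrixP => i j; rewrite !mxE rmorphD. Qed.

Lemma adjmxN m n (A : 'M[C]_(m, n)) : adjmx (- A) = - adjmx A.
Proof. by apply/matrixP => i j; rewrite !mxE rmorphN. Qed.

Lemma qformE n (A : 'M[C]_n) (v : 'rV[C]_n) :
  (v *m A *m adjmx v) 0 0 = \sum_a \sum_b A a b * (v 0 a * (v 0 b)^*).
Proof.
rewrite mxE; under eq_bigr do rewrite mxE adjmxE mulr_suml.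
rewrite exchange_big; apply: eq_bigr => a _; apply: eq_bigr => b _ /=.
by ring.
Qed.

Definition psdk (T : finType) (K : T -> T -> C) : Prop :=
  forall u : T -> C, 0 <= \sum_a \sum_b K a b * (u a * (u b)^*).

(* Polarization, at e_a + e_b and e_a + i e_b. *)
Lemma psdk_herm (T : finType) (K : T -> T -> C) a b :
  psdk K -> K a b = (K b a)^*.
Proof.
move=> K0.
have diag x : 0 <= K x x.
  have := K0 (fun y => (y == x)%:R).
  rewrite (bigD1 x) //= (bigD1 x) //= !eqxx big1 ?addr0; last first.
    by move=> y /negbTE ->; rewrite mulr1n rmorph0 !mulr0.
  rewrite big1 ?addr0 ?rmorph1 ?mulr1 //.
  by move=> y /negbTE ->; rewrite big1 // => t _; rewrite mul0r mulr0.
have [->|ab] := eqVneq a b; first by rewrite conj_Creal // ger0_real.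
have two (s t : C) : 0 <= K a a * (s * s^*) + K a b * (s * t^*)
    + (K b a * (t * s^*) + K b b * (t * t^*)).
  pose f y := if y == a then s else if y == b then t else 0.
  have fa : f a = s by rewrite /f eqxx.
  have fb : f b = t by rewrite /f eq_sym (negbTE ab) eqxx.
  have f0 y : (y != a) && (y != b) -> f y = 0.
    by rewrite /f => /andP[/negbTE -> /negbTE ->].
  have line x r : \sum_y K x y * (r * (f y)^*) =
      K x a * (r * s^*) + K x b * (r * t^*).
    rewrite (bigD1 a) //= (bigD1 b) 1?eq_sym //= fa fb big1 ?addr0 //.
    by move=> y /f0 ->; rewrite rmorph0 !mulr0.
  have := K0 f; under eq_bigr do rewrite line.
  rewrite (bigD1 a) //= (bigD1 b) 1?eq_sym //= fa fb big1 ?addr0 //.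
  by move=> y /f0 ->; rewrite !mul0r !mulr0 addr0.
have re (x y z : C) : 0 <= x -> 0 <= z -> 0 <= x + y + z -> y^* = y.
  move=> x0 z0 h; apply: conj_Creal.
  rewrite (_ : y = (x + y + z) - (x + z)); last by ring.
  by rewrite rpredB ?ger0_real // addr_ge0.
have h1 : (K a b + K b a)^* = K a b + K b a.
  apply: (@re (K a a) _ (K b b)) => //.
  by have := two 1 1; rewrite rmorph1 !mulr1 !addrA.
have h2 : (K a b * - 'i + K b a * 'i)^* = K a b * - 'i + K b a * 'i.
  apply: (@re (K a a) _ (K b b)) => //.
  have := two 1 'i; rewrite rmorph1 conjCi.
  by congr (0 <= _); ring: (sqrCi C).
move: h1 h2; rewrite !(rmorphD, rmorphM, rmorphN) /= conjCi opprK => h1 h2.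
apply: (@mulfI _ (2 * 'i)); first by rewrite mulf_neq0 ?neq0Ci ?pnatr_eq0.
have e1 : (K a b)^* = K a b + K b a - (K b a)^* by rewrite -h1 addrK.
move: h2; rewrite e1 => h2.
apply/eqP; rewrite -subr_eq0; apply/eqP.
move/eqP: h2; rewrite -subr_eq0 => /eqP <-; ring.
Qed.

Lemma psdmxP n (A : 'M[C]_n) : psdmx A <-> psdk (fun a b => A a b).
Proof.
split=> [[_ A0] u|A0].
  have := A0 (\row_a u a); rewrite qformE.
  by under eq_bigr do under eq_bigr do rewrite !mxE.
split; last by move=> v; rewrite qformE; apply: A0.
by apply/matrixP => a b; rewrite adjmxE; apply: (psdk_herm a b A0).
Qed.

Lemma psdmx_spectral n (A : 'M[C]_n) : psdmx A ->
  let P := spectralmx A in let l := spectral_diag A in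
  [/\ P *m adjmx P = 1%:M, adjmx P *m P = 1%:M,
      A = adjmx P *m diag_mx l *m P & forall s, 0 <= l 0 s].
Proof.
move=> [hA A0] P l.
have uP : P \is unitarymx by apply: spectral_unitarymx.
have adjE m (B : 'M[C]_m) : map_mx Num.conj B^T = adjmx B.
  by rewrite /adjmx map_trmx.
have PP : P *m adjmx P = 1%:M.
  by have /unitarymxP := uP; rewrite adjE.
have PP' : adjmx P *m P = 1%:M by apply: mulmx1C.
have nA : A \is normalmx by apply/normalmxP; rewrite adjE -hA.
have eA : A = adjmx P *m diag_mx l *m P.
  have /orthomx_spectralP := nA; rewrite -/P -/l => {1}->.
  by rewrite invmx_unitary // adjE.
split=> // s.
(* A row of P is an eigenvector, so the form evaluated there is the eigenvalue. *)
have -> : l 0 s = (row s P *m A *m adjmx (row s P)) 0 0.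
  have -> : row s P = delta_mx 0 s *m P by rewrite rowE.
  rewrite eA adjmxM !mulmxA -(mulmxA _ P (adjmx P)) PP mulmx1.
  rewrite -(mulmxA _ P (adjmx P)) PP mulmx1 -rowE.
  rewrite mxE (bigD1 s) //= !mxE !eqxx mulr1n /= rmorph1 mulr1.
  rewrite big1 ?addr0 // => t /negbTE ts.
  by rewrite !mxE eq_sym ts mulr0n mul0r.
exact: A0.
Qed.

Lemma psdmx_gram n (A : 'M[C]_n) : psdmx A ->
  exists g : 'I_n -> 'I_n -> C, forall a b, A a b = \sum_s g s a * (g s b)^*.
Proof.
move=> /psdmx_spectral [_ _ eA l0].
exists (fun s a => (spectralmx A s a)^* * sqrtC (spectral_diag A 0 s)) => a b.
rewrite {1}eA !mxE; apply: eq_bigr => s _.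
rewrite mul_mx_diag !mxE rmorphM /= conjCK (conj_Creal (x := sqrtC _)).
  by rewrite mulrACA -[sqrtC _ * _]expr2 sqrtCK mulrAC.
by rewrite ger0_real // sqrtC_ge0.
Qed.

Lemma psdk_gram d (K : 'I_d -> 'I_d -> C) : psdk K ->
  exists g : 'I_d -> 'I_d -> C, forall a b, K a b = \sum_s g s a * (g s b)^*.
Proof.
move=> K0; have [|g gE] := @psdmx_gram d (\matrix_(a, b) K a b).
  by apply/psdmxP => u; under eq_bigr do under eq_bigr do rewrite mxE.
by exists g => a b; rewrite -gE mxE.
Qed.

Lemma sqr_nrm_tr n (A : 'M[C]_n) :
  \tr (A *m adjmx A) = nrm2 (fun a b => A a b).
Proof.
rewrite /mxtrace; apply: eq_bigr => a _; rewrite mxE.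
by apply: eq_bigr => b _; rewrite adjmxE normCK.
Qed.

(** In eigenvalues this is sum l^2 <= (sum l)^2, which holds because they are nonnegative. *)
Lemma psdk_nrm2_le d (K : 'I_d -> 'I_d -> C) : psdk K ->
  nrm2 K <= (\sum_a K a a) ^+ 2.
Proof.
move=> K0; pose A := \matrix_(a, b) K a b.
have A0 : psdmx A.
  by apply/psdmxP => u; under eq_bigr do under eq_bigr do rewrite mxE.
have -> : nrm2 K = \tr (A *m adjmx A).
  rewrite sqr_nrm_tr; apply: eq_bigr => a _; apply: eq_bigr => b _.
  by rewrite mxE.
have -> : \sum_a K a a = \tr A by apply: eq_bigr => a _; rewrite mxE.
have [PP P'P eA l0] := psdmx_spectral A0.
set P := spectralmx A in PP P'P eA; set l := spectral_diag A in eA l0.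
have -> : \tr A = \sum_s l 0 s.
  by rewrite eA mxtrace_mulC mulmxA PP mul1mx mxtrace_diag.
have -> : \tr (A *m adjmx A) = \sum_s l 0 s ^+ 2.
  rewrite -(proj1 A0) eA -!mulmxA [P *m (_ *m _)]mulmxA PP mul1mx.
  rewrite mxtrace_mulC -!mulmxA PP mulmx1 mulmx_diag mxtrace_diag.
  by apply: eq_bigr => s _; rewrite mxE.
rewrite expr2 mulr_suml; apply: ler_sum => s _.
rewrite expr2 ler_wpM2l // (bigD1 s) //= lerDl.
by apply: sumr_ge0 => t _.
Qed.

End PSD.

(** * Purity gain of a measurement *)

Section Functionals.
Context {C : numClosedFieldType}.
Variables (n d : nat).

Definition kern := 'I_d -> 'I_d -> C.

Definition upd (N : 'I_n -> kern) (k : 'I_n) (A : kern) : 'I_n -> kern :=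
  fun l => if l == k then A else N l.

Definition idk : kern := fun a b => (a == b)%:R.
Definition delk (x y : 'I_d) : kern := fun a b => ((a == x) && (b == y))%:R.
Definition rank1 (v : 'I_d -> C) : kern := fun a b => v a * (v b)^*.
Definition ones : 'I_n -> kern := fun=> idk.

(* [T] stands for [N |-> tr (rho (N_1 (x) ... (x) N_n))]; the sites in [S] have
   been measured and [T] no longer reads them. *)
Record pfun (S : {set 'I_n}) (T : ('I_n -> kern) -> C) : Prop := PFun {
  pfun_lin : forall k N A, k \notin S ->
    T (upd N k A) = \sum_a \sum_b A a b * T (upd N k (delk a b));
  pfun_ge0 : forall N, (forall k, psdk (N k)) -> 0 <= T N }.

(** [T] is not normalised: [mass] plays the role of the probability of the outcomes recorded so far,
    and [red] and [red2] are one- and two-site marginals multiplied by it. *)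
Definition mass (T : ('I_n -> kern) -> C) : C := T ones.
Definition red (T : ('I_n -> kern) -> C) (i : 'I_n) : kern :=
  fun a b => T (upd ones i (delk a b)).
Definition red2 (T : ('I_n -> kern) -> C) (i j : 'I_n) (a b : 'I_d) : kern :=
  fun x y => T (upd (upd ones i (delk a b)) j (delk x y)).
Definition meas (T : ('I_n -> kern) -> C) (j : 'I_n) (w : C) (v : 'I_d -> C) :=
  fun N => w * T (upd N j (rank1 v)).

Lemma updC N i j A B : i != j -> upd (upd N i A) j B = upd (upd N j B) i A.
Proof.
move=> ij; apply: funext => k; rewrite /upd.
by have [->|//] := eqVneq k j; rewrite eq_sym (negbTE ij).
Qed.

Lemma upd_id N i : upd N i (N i) = N.
Proof. by apply: funext => k; rewrite /upd; case: eqVneq => [->|]. Qed.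

Lemma upd_ones i : upd ones i idk = ones.
Proof. exact: (upd_id ones i). Qed.

Lemma psdk_rank1 v : psdk (rank1 v).
Proof.
move=> u; rewrite [X in 0 <= X](_ : _ = `|\sum_a v a * u a| ^+ 2).
  by rewrite exprn_ge0.
rewrite normCK rmorph_sum mulr_suml; apply: eq_bigr => a _.
rewrite mulr_sumr; apply: eq_bigr => b _; rewrite rmorphM /rank1 /=; ring.
Qed.

Lemma sum_idk (F : kern) : \sum_a \sum_b idk a b * F a b = \sum_a F a a.
Proof.
apply: eq_bigr => a _; rewrite (bigD1 a) //= big1 /idk ?eqxx ?mul1r ?addr0 //.
by move=> b ba; rewrite eq_sym (negbTE ba) mul0r.
Qed.

Lemma psdk_idk : psdk idk.
Proof.
move=> u; rewrite (sum_idk (fun a b => u a * (u b)^*)).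
by apply: sumr_ge0 => a _; apply: mul_conjC_ge0.
Qed.

Lemma psdk_upd N i A :
  (forall k, psdk (N k)) -> psdk A -> forall k, psdk (upd N i A k).
Proof. by move=> N0 A0 k; rewrite /upd; case: eqP. Qed.

Lemma psdk_ones k : psdk (ones k).
Proof. exact: psdk_idk. Qed.

Section One.
Variables (S : {set 'I_n}) (T : ('I_n -> kern) -> C).
Hypothesis HT : pfun S T.

Lemma mass_ge0 : 0 <= mass T.
Proof. by apply: (pfun_ge0 HT) => k; apply: psdk_ones. Qed.

Lemma tr_red i : i \notin S -> \sum_a red T i a a = mass T.
Proof.
by move=> iS; rewrite -sum_idk -(pfun_lin HT) // upd_ones.
Qed.

Lemma red_rank1 i u : i \notin S ->
  \sum_a \sum_b red T i a b * (u a * (u b)^*) = T (upd ones i (rank1 u)).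
Proof.
move=> iS; rewrite (pfun_lin HT) //; apply: eq_bigr => a _.
by apply: eq_bigr => b _; rewrite mulrC.
Qed.

Lemma psdk_red i : i \notin S -> psdk (red T i).
Proof.
move=> iS u; rewrite red_rank1 //; apply: (pfun_ge0 HT).
exact: (psdk_upd i psdk_ones (psdk_rank1 u)).
Qed.

Lemma nrm2_red i : i \notin S -> nrm2 (red T i) <= mass T ^+ 2.
Proof. by move=> iS; rewrite -(tr_red iS) psdk_nrm2_le //; apply: psdk_red. Qed.

(** The squared norm of the marginal is at most the squared mass. Hence outcomes of probability
    zero, where division returns 0, do no harm. *)
Lemma red_mass0 i a b : i \notin S -> mass T = 0 -> red T i a b = 0.
Proof.
move=> iS m0; have := nrm2_red iS; rewrite m0 expr0n /= => h.
have {}h : nrm2 (red T i) = 0 by apply: le_anti; rewrite h nrm2_ge0.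
have := psumr_eq0P _ h => h1.
have {}h1 : nrm1 (red T i a) = 0.
  by apply: h1 => // x _; apply: nrm1_ge0.
have := psumr_eq0P _ h1 => h2.
have : `|red T i a b| ^+ 2 = 0 by apply: h2 => // x _; rewrite exprn_ge0.
by move/eqP; rewrite sqrf_eq0 normr_eq0 => /eqP.
Qed.

Lemma tr2_red2 i j a b : i != j -> j \notin S ->
  \sum_x red2 T i j a b x x = red T i a b.
Proof.
move=> ij jS; rewrite -sum_idk -(pfun_lin HT) // updC //.
by rewrite upd_ones.
Qed.

Lemma pfun_meas j w v : 0 <= w -> pfun (j |: S) (meas T j w v).
Proof.
move=> w0; split.
  move=> k N A; rewrite !inE negb_or => /andP[kj kS].
  rewrite /meas updC // (pfun_lin HT) // mulr_sumr; apply: eq_bigr => a _.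
  rewrite mulr_sumr; apply: eq_bigr => b _.
  by rewrite mulrCA updC // eq_sym.
move=> N N0; rewrite /meas mulr_ge0 //; apply: (pfun_ge0 HT).
exact: (psdk_upd j N0 (psdk_rank1 v)).
Qed.

End One.

(* Purity gained by [i] when [j] is measured. *)
Definition incr (T : ('I_n -> kern) -> C) (W : finType) (w : W -> C)
    (v : W -> 'I_d -> C) (j i : 'I_n) : C :=
  \sum_o nrm2 (red (meas T j (w o) (v o)) i) / mass (meas T j (w o) (v o))
  - nrm2 (red T i) / mass T.

(** With A and P the totals, the right side is the weighted variance sum of p |a / p - A / P|^2 of
    the conditional values. The second hypothesis covers p z = 0, where division returns 0. *)
Lemma variance_id (Z : finType) (p a : Z -> C) :
  (forall z, 0 <= p z) -> (forall z, p z = 0 -> a z = 0) ->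
  \sum_z `|a z| ^+ 2 / p z - `|\sum_z a z| ^+ 2 / \sum_z p z =
  \sum_z `|a z - (\sum_z a z) * (p z / \sum_z p z)| ^+ 2 / p z.
Proof.
move=> p0 pa; set A := \sum_z a z; set P := \sum_z p z.
have P0 : 0 <= P by apply: sumr_ge0.
have cP : P^* = P by rewrite conj_Creal // ger0_real.
have cp z : (p z)^* = p z by rewrite conj_Creal // ger0_real.
have eqz z : `|a z - A * (p z / P)| ^+ 2 / p z = `|a z| ^+ 2 / p z
   - (a z * (A^* / P) + (a z)^* * (A / P)) + `|A| ^+ 2 / P ^+ 2 * p z.
  have [pz|pz] := eqVneq (p z) 0.
    by rewrite pz pa // !(mul0r, mulr0, invr0, rmorph0, subr0, addr0).
  rewrite !normCK !(rmorphB, rmorphM, fmorphV) /= cP cp.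
  have [->|PN] := eqVneq P 0; last by field; rewrite pz PN.
  by rewrite expr0n /= !invr0 !(mulr0, mul0r, subr0, addr0).
under [RHS]eq_bigr do rewrite eqz.
rewrite big_split sumrB /= big_split /= -!mulr_suml -rmorph_sum -/A.
rewrite -mulr_sumr -/P.
have [->|PN] := eqVneq P 0.
  by rewrite !expr0n /= !invr0 !(mulr0, mul0r, subr0, addr0).
by rewrite !normCK; field.
Qed.

(** * The purity gain controls the pair correlation *)

Section Increment.
Variables (S : {set 'I_n}) (T : ('I_n -> kern) -> C).
Hypothesis HT : pfun S T.
Variables (W : finType) (w : W -> C) (v : W -> 'I_d -> C).
Hypothesis dsg : design w v.
Variables (i j : 'I_n).
Hypotheses (iS : i \notin S) (jS : j \notin S) (ij : i != j).

Let m o := mass (meas T j (w o) (v o)).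
Let r o := red (meas T j (w o) (v o)) i.
Let p := mass T.
Let bt o := T (upd ones j (rank1 (v o))).

(** The correlation xi for an unnormalised [T], hence the division by the mass. It is a kernel at j
    for each entry (a, b) at i, so that [cquad] applies entry by entry. *)
Definition corr (a b : 'I_d) : kern :=
  fun x y => red2 T i j a b x y - red T i a b * (red T j x y / mass T).

Let m_ge0 o : 0 <= m o.
Proof. exact: mass_ge0 (pfun_meas HT j (v o) (design_ge0 dsg o)). Qed.

Let bt_ge0 o : 0 <= bt o.
Proof.
by apply: (pfun_ge0 HT); exact: (psdk_upd j psdk_ones (psdk_rank1 _)).
Qed.

Lemma design_resolution x y : \sum_o w o * rank1 (v o) x y = idk x y.
Proof. exact: (design_pov dsg). Qed.

(** The weighted rank-one effects sum to the identity, so forgetting the outcome leaves the identity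
    at j. *)
Lemma pfun_resolution N : \sum_o w o * T (upd N j (rank1 (v o))) =
  T (upd N j idk).
Proof.
rewrite [RHS](pfun_lin HT) //.
under eq_bigr do rewrite (pfun_lin HT) // mulr_sumr.
rewrite exchange_big; apply: eq_bigr => a _ /=.
under eq_bigr do rewrite mulr_sumr.
rewrite exchange_big; apply: eq_bigr => b _ /=.
by rewrite -design_resolution mulr_suml; apply: eq_bigr => o _; rewrite mulrA.
Qed.

Lemma mass_meas_sum : \sum_o m o = p.
Proof. by rewrite /m /mass /meas pfun_resolution upd_ones. Qed.

Lemma red_meas_sum a b : \sum_o r o a b = red T i a b.
Proof.
rewrite /r /red /meas pfun_resolution updC // upd_ones //.
Qed.

Lemma red_meas o a b : r o a b =
  w o * \sum_x \sum_y red2 T i j a b x y * (v o x * (v o y)^*).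
Proof.
rewrite /r /red /meas (pfun_lin HT) //; congr (_ * _).
by apply: eq_bigr => x _; apply: eq_bigr => y _; rewrite mulrC.
Qed.

Lemma corr_tr a b : \sum_x corr a b x x = 0.
Proof.
rewrite /corr sumrB (tr2_red2 HT) // -mulr_sumr -mulr_suml (tr_red HT) //.
have [p0|pN] := eqVneq (mass T) 0; last by rewrite divff // mulr1 subrr.
by rewrite (red_mass0 HT) // mul0r subr0.
Qed.

(** As [corr] has trace zero, its centred form is the plain one. It measures how far the marginal of
    i under outcome o deviates from the share m o / p of the marginal before measuring. *)
Lemma cquad_corr o a b :
  w o * cquad (corr a b) (v o) = r o a b - red T i a b * (m o / p).
Proof.
rewrite /cquad corr_tr subr0 red_meas.
have -> : m o = w o * \sum_x \sum_y red T j x y * (v o x * (v o y)^*).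
  by rewrite (red_rank1 HT).
rewrite [X in _ - X](_ : _ = w o * \sum_x \sum_y
    red T i a b * (red T j x y / p) * (v o x * (v o y)^*)); last first.
  set s := \sum_x _.
  rewrite [LHS](_ : _ = w o * (red T i a b / p * s)); last by ring.
  congr (_ * _); rewrite mulr_sumr; apply: eq_bigr => x _; rewrite mulr_sumr.
  by apply: eq_bigr => y _; ring.
rewrite -mulrBr -sumrB; congr (_ * _); apply: eq_bigr => x _.
by rewrite -sumrB; apply: eq_bigr => y _; rewrite -mulrBl.
Qed.

(** Entry by entry, the gain is a variance over the outcomes by [variance_id], and [cquad_corr]
    identifies the deviations. *)
Lemma incr_variance : incr T w v j i =
  \sum_a \sum_b \sum_o `|w o * cquad (corr a b) (v o)| ^+ 2 / m o.
Proof.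
rewrite /incr /nrm2.
under eq_bigr do rewrite mulr_suml.
rewrite exchange_big mulr_suml -sumrB; apply: eq_bigr => a _ /=.
under eq_bigr do rewrite mulr_suml.
rewrite exchange_big mulr_suml -sumrB; apply: eq_bigr => b _ /=.
under [RHS]eq_bigr do rewrite cquad_corr -red_meas_sum -/p -mass_meas_sum.
rewrite -variance_id //; first by rewrite red_meas_sum mass_meas_sum.
move=> o m0; apply: (red_mass0 (pfun_meas HT j (v o) (design_ge0 dsg o))) => //.
by rewrite !inE negb_or ij.
Qed.

Lemma incr_ge0 : 0 <= incr T w v j i.
Proof.
rewrite incr_variance; apply: sumr_ge0 => a _; apply: sumr_ge0 => b _.
by apply: sumr_ge0 => o _; rewrite divr_ge0 // exprn_ge0.
Qed.

Lemma nrm2_corr a b :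
  \sum_o w o * `|cquad (corr a b) (v o)| ^+ 2 = nrm2 (corr a b).
Proof. exact: (design_quad2 dsg). Qed.

(** [design_quad4] bounds the third moment against |<u, v>|^2 for every vector u. Read as positivity
    of the kernel K below, it can be evaluated by the positive functional [T] at site j, which
    replaces |<u, v>|^2 by bt o. *)
Lemma nrm2_corr_bt a b :
  \sum_o w o * (`|cquad (corr a b) (v o)| ^+ 2 * bt o)
  <= 4 * nrm2 (corr a b) * p.
Proof.
set Y := corr a b; pose q o := `|cquad Y (v o)| ^+ 2.
pose K : kern := fun x y => 4 * nrm2 Y * idk x y
  - \sum_o w o * (q o * rank1 (v o) x y).
have K0 : psdk K.
  move=> u; rewrite [X in 0 <= X](_ : _ = 4 * nrm2 Y * nrm1 u
      - \sum_o w o * (q o * `|antilin (fun x => (u x)^*) (v o)| ^+ 2)).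
    rewrite subr_ge0 -mulrA (_ : nrm1 u = nrm1 (fun x => (u x)^*)).
      exact: (design_quad4 dsg).
    by apply: eq_bigr => x _; rewrite norm_conjC.
  have -> : nrm1 u = \sum_x \sum_y idk x y * (u x * (u y)^*).
    rewrite (sum_idk (fun x y => u x * (u y)^*)).
    by apply: eq_bigr => x _; rewrite normCK.
  have eo o : w o * (q o * `|antilin (fun x => (u x)^*) (v o)| ^+ 2) =
      \sum_x \sum_y w o * (q o * rank1 (v o) x y) * (u x * (u y)^*).
    rewrite normCK mulrC /antilin rmorph_sum /= mulrC.
    rewrite [X in q o * X]mulrC !mulr_suml !mulr_sumr.
    apply: eq_bigr => x _; rewrite !mulr_sumr.
    apply: eq_bigr => y _; rewrite /rank1 !rmorphM /= !conjCK; ring.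
  under [X in _ - X]eq_bigr do rewrite eo.
  rewrite [X in _ - X]exchange_big mulr_sumr -sumrB; apply: eq_bigr => x _ /=.
  rewrite [X in _ - X]exchange_big mulr_sumr -sumrB; apply: eq_bigr => y _ /=.
  by rewrite /K mulrBl mulr_suml mulrA.
have pE : p = \sum_x \sum_y idk x y * T (upd ones j (delk x y)).
  by rewrite -(pfun_lin HT) // upd_ones.
rewrite -subr_ge0; have := pfun_ge0 HT (psdk_upd j psdk_ones K0); congr (0 <= _).
rewrite (pfun_lin HT) // pE.
under [X in _ - X]eq_bigr do rewrite /bt (pfun_lin HT) // !mulr_sumr.
rewrite [X in _ - X]exchange_big mulr_sumr -sumrB; apply: eq_bigr => x _ /=.
under [X in _ - X]eq_bigr do rewrite !mulr_sumr.
rewrite [X in _ - X]exchange_big mulr_sumr -sumrB; apply: eq_bigr => y _ /=.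
rewrite /K mulrBl mulr_suml mulrA; congr (_ - _).
by apply: eq_bigr => o _; rewrite /q !mulrA.
Qed.

(** All outcomes have mass zero, so [cquad] of the correlation vanishes wherever the weight does
    not, and the isometry [design_quad2] forces the correlation to be zero. *)
Lemma mass0_corr a b x y : mass T = 0 -> corr a b x y = 0.
Proof.
move=> p0.
have ms0 : \sum_o m o = 0 by rewrite mass_meas_sum.
have mo o : m o = 0.
  by apply: (psumr_eq0P _ ms0) => // o' _; apply: m_ge0.
have : nrm2 (corr a b) = 0.
  rewrite -nrm2_corr big1 // => o _.
  have [->|w0] := eqVneq (w o) 0; first by rewrite mul0r.
  suff /eqP : w o * cquad (corr a b) (v o) = 0.
    by rewrite mulf_eq0 (negbTE w0) => /= /eqP ->; rewrite normr0 expr0n mulr0.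
  rewrite cquad_corr mo mul0r mulr0 subr0.
  apply: (red_mass0 (pfun_meas HT j (v o) (design_ge0 dsg o))) => //.
    by rewrite !inE negb_or ij.
  exact: mo.
move=> h.
have {}h : nrm1 (corr a b x) = 0.
  by apply: (psumr_eq0P _ h) => // z _; apply: nrm1_ge0.
have : `|corr a b x y| ^+ 2 = 0.
  by apply: (psumr_eq0P _ h) => // z _; rewrite exprn_ge0.
by move/eqP; rewrite sqrf_eq0 normr_eq0 => /eqP.
Qed.

(** Cauchy-Schwarz between the gain, weighted by 1 / bt, and the third moment, weighted by bt, in
    the linearised form 2 l c <= c / bt + l^2 c bt with c = |cquad|^2. *)
Lemma corr_incr :
  (\sum_a \sum_b nrm2 (corr a b)) / mass T <= 4 * incr T w v j i.
Proof.
have [p0|pN] := eqVneq p 0.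
  by rewrite -/p p0 invr0 mulr0 mulr_ge0 // incr_ge0.
have pp : 0 < p by rewrite lt_def pN (mass_ge0 HT).
rewrite incr_variance mulr_suml mulr_sumr; apply: ler_sum => a _.
rewrite mulr_suml mulr_sumr; apply: ler_sum => b _.
(* With N = [nrm2 Y], summing over the outcomes gives 2 l N <= gain + l^2 (4 N p) = gain + l N for
   this choice of l. *)
set Y := corr a b; pose l := (4 * p)^-1.
have l0 : 0 < l by rewrite invr_gt0 mulr_gt0.
have step o : 2 * l * (w o * `|cquad Y (v o)| ^+ 2) <=
    `|w o * cquad Y (v o)| ^+ 2 / m o
    + l ^+ 2 * (w o * (`|cquad Y (v o)| ^+ 2 * bt o)).
  have mE : m o = w o * bt o by [].
  rewrite normrM exprMn (ger0_norm (design_ge0 dsg o)).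
  set c := `|_| ^+ 2; have c0 : 0 <= c by rewrite exprn_ge0.
  have [w0|wN] := eqVneq (w o) 0.
    by rewrite w0 !(mul0r, mulr0) expr0n /= !mul0r addr0.
  have [b0|bN] := eqVneq (bt o) 0.
    suff -> : c = 0 by rewrite !(mul0r, mulr0) addr0.
    have : w o * cquad Y (v o) = 0.
      rewrite cquad_corr mE b0 mulr0 mul0r mulr0 subr0.
      apply: (red_mass0 (pfun_meas HT j (v o) (design_ge0 dsg o))) => //.
        by rewrite !inE negb_or ij.
      by rewrite -/(m o) mE b0 mulr0.
    by move/eqP; rewrite mulf_eq0 (negbTE wN) /c => /= /eqP ->; rewrite normr0 expr0n.
  rewrite -subr_ge0 mE.
  rewrite [X in 0 <= X](_ : _ = w o * c * (l * bt o - 1) ^+ 2 / bt o).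
    rewrite divr_ge0 ?bt_ge0 // mulr_ge0 //.
      by rewrite mulr_ge0 // (design_ge0 dsg).
    rewrite real_exprn_even_ge0 // rpredB ?rpred1 // ger0_real //.
    by rewrite mulr_ge0 // ltW.
  by field; rewrite wN bN.
have := ler_sum (index_enum W) (fun o (_ : true) => step o).
rewrite big_split -!mulr_sumr /= nrm2_corr => h.
have h' := le_trans h (lerD (lexx _)
  (ler_wpM2l (exprn_ge0 2 (ltW l0)) (nrm2_corr_bt a b))).
have lE : l ^+ 2 * (4 * nrm2 Y * p) = l * nrm2 Y.
  by rewrite /l; field.
rewrite -/Y lE in h'.
have h2 : l * nrm2 Y <= \sum_o `|w o * cquad Y (v o)| ^+ 2 / m o.
  rewrite -(lerD2r (l * nrm2 Y)) (le_trans _ h') // le_eqVlt.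
  by apply/orP; left; apply/eqP; ring.
have -> : nrm2 Y / mass T = 4 * (l * nrm2 Y).
  by rewrite /l -/p; field.
by rewrite ler_wpM2l.
Qed.

End Increment.
End Functionals.

(** * Greedy measurements *)

Section Ensembles.
Context {C : numClosedFieldType}.
Variables (n d : nat).
Variables (W : finType) (w : W -> C) (v : W -> 'I_d -> C).
Hypothesis dsg : design w v.
Variable T0 : ('I_n -> @kern C d) -> C.
Hypothesis T01 : T0 (@ones C n d) = 1.

(** The outcomes z of measuring the sites in S. They add up to [T0] on arguments that are the
    identity on S, since the [T z] no longer read these sites. *)
Record ens (S : {set 'I_n}) (Z : finType)
    (T : Z -> ('I_n -> @kern C d) -> C) : Prop := Ens {
  ens_pfun : forall z, pfun S (T z);
  ens_sum : forall N, (forall k, k \in S -> N k = @idk C d) ->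
    \sum_z T z N = T0 N }.

Definition incr_tot (Z : finType) (T : Z -> ('I_n -> @kern C d) -> C) j i :=
  \sum_z incr (T z) w v j i.

Definition purity (Z : finType) (T : Z -> ('I_n -> @kern C d) -> C) i :=
  \sum_z nrm2 (red (T z) i) / mass (T z).

Definition potential (S : {set 'I_n}) (Z : finType)
    (T : Z -> ('I_n -> @kern C d) -> C) : C :=
  \sum_(i | i \notin S) purity T i + #|S|%:R.

Definition measens (Z : finType) (T : Z -> ('I_n -> @kern C d) -> C) j :=
  fun zo : Z * W => meas (T zo.1) j (w zo.2) (v zo.2).

Lemma ens_meas (S : {set 'I_n}) (Z : finType) (T : Z -> ('I_n -> @kern C d) -> C) j :
  j \notin S -> ens S T -> ens (j |: S) (measens T j).
Proof.
move=> jS HT; split.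
  by move=> [z o]; apply: (pfun_meas (ens_pfun HT z)); apply: (design_ge0 dsg).
move=> N NS; rewrite -(pair_bigA _ (fun z o => meas (T z) j (w o) (v o) N)) /=.
rewrite -(ens_sum HT); last by move=> k kS; apply: NS; rewrite !inE kS orbT.
apply: eq_bigr => z _; rewrite (pfun_resolution (ens_pfun HT z) dsg) //.
by rewrite -(NS j) ?upd_id // !inE eqxx.
Qed.

Section Fixed.
Variables (S : {set 'I_n}) (Z : finType) (T : Z -> ('I_n -> @kern C d) -> C).
Hypothesis HT : ens S T.

Lemma ens_mass : \sum_z mass (T z) = 1.
Proof. by rewrite (ens_sum HT). Qed.

Lemma purity_le1 i : i \notin S -> purity T i <= 1.
Proof.
move=> iS; rewrite -ens_mass; apply: ler_sum => z _.
have Hz := ens_pfun HT z; have m0 := mass_ge0 Hz.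
have [->|mN] := eqVneq (mass (T z)) 0; first by rewrite invr0 mulr0.
by rewrite ler_pdivrMr ?lt_def ?mN // -expr2 (nrm2_red Hz).
Qed.

Lemma purity_ge0 i : 0 <= purity T i.
Proof.
apply: sumr_ge0 => z _; rewrite divr_ge0 ?nrm2_ge0 //.
exact: mass_ge0 (ens_pfun HT z).
Qed.

Lemma potential_ge0 : 0 <= potential S T.
Proof. by rewrite addr_ge0 // sumr_ge0 // => i _; apply: purity_ge0. Qed.

Lemma potential_le : potential S T <= n%:R.
Proof.
have : potential S T <= \sum_(i | i \notin S) 1 + #|S|%:R.
  by rewrite lerD2r; apply: ler_sum => i; apply: purity_le1.
rewrite sumr_const -natrD => /le_trans; apply; rewrite ler_nat.
rewrite (eq_card (B := ~: S)); last by move=> i; rewrite !inE.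
by rewrite addnC cardsC card_ord.
Qed.

(** Site j leaves the sum with a purity of at most one and comes back as one in the cardinality, so
    the gains of the other sites are all kept. *)
Lemma potential_meas j : j \notin S ->
  potential S T + \sum_(i | (i \notin S) && (i != j)) incr_tot T j i
  <= potential (j |: S) (measens T j).
Proof.
move=> jS; rewrite /potential cardsU1 jS natrD (bigD1 j) //=.
have -> : \sum_(i | i \notin j |: S) purity (measens T j) i =
    \sum_(i | (i \notin S) && (i != j)) (purity T i + incr_tot T j i).
  rewrite (eq_bigl (fun i => (i \notin S) && (i != j))); last first.
    by move=> i; rewrite !inE negb_or andbC.
  apply: eq_bigr => i _; rewrite /purity /incr_tot -big_split /=.
  rewrite -(pair_bigA _ (fun z o => nrm2 (red (meas (T z) j (w o) (v o)) i)
     / mass (meas (T z) j (w o) (v o)))) /=.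
  by apply: eq_bigr => z _; rewrite /incr addrC subrK.
rewrite big_split /=; set A := \sum_(_ | _) purity T _.
set B := \sum_(_ | _) _.
rewrite [leLHS](_ : _ = A + B + (purity T j + #|S|%:R)); last by ring.
by rewrite lerD2l lerD2r purity_le1.
Qed.

Lemma incr_tot_ge0 i j : i \notin S -> j \notin S -> i != j ->
  0 <= incr_tot T j i.
Proof.
by move=> iS jS ij; apply: sumr_ge0 => z _; apply: (incr_ge0 (ens_pfun HT z)).
Qed.

End Fixed.

Lemma greedy_measurement (eps : C) : 0 <= eps -> pfun finset.set0 T0 ->
  exists (S : {set 'I_n}) (Z : finType) (T : Z -> ('I_n -> @kern C d) -> C),
    [/\ ens S T, #|S|%:R * eps <= n%:R &
      forall j, j \notin S ->
        \sum_(i | (i \notin S) && (i != j)) incr_tot T j i <= eps].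
Proof.
move=> eps0 HT0.
(* The invariant says that the potential pays eps for each measured site; [potential_le] then bounds
   their number. The induction is on the number of unmeasured sites. *)
suff: forall k (S : {set 'I_n}) (Z : finType) (T : Z -> ('I_n -> @kern C d) -> C),
    (n - #|S| <= k)%N -> ens S T -> #|S|%:R * eps <= potential S T ->
  exists (S : {set 'I_n}) (Z : finType) (T : Z -> ('I_n -> @kern C d) -> C),
    [/\ ens S T, #|S|%:R * eps <= n%:R &
      forall j, j \notin S ->
        \sum_(i | (i \notin S) && (i != j)) incr_tot T j i <= eps].
  have E0 : ens finset.set0 (fun _ : unit => T0).
    split=> // N _; rewrite big_const cardT enumT unlock /=.
    by rewrite addr0.
  move=> /(_ n finset.set0 unit (fun=> T0)); apply => //.
    by rewrite cards0 subn0.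
  by rewrite cards0 mul0r (potential_ge0 E0).
elim=> [|k IH] S Z T nS HT pS.
  exists S, Z, T; split=> //; first exact: le_trans pS (potential_le HT).
  move=> j jS; have : (#|j |: S| <= n)%N by rewrite -[n in (_ <= n)%N]card_ord max_card.
  by rewrite cardsU1 jS add1n ltnNge -subn_eq0 -leqn0 nS.
have [h|] := pselect (forall j, j \notin S ->
    \sum_(i | (i \notin S) && (i != j)) incr_tot T j i <= eps).
  by exists S, Z, T; split=> //; exact: le_trans pS (potential_le HT).
move=> /existsNP[j /not_implyP[jS /negP hj]].
apply: (IH (j |: S) _ (measens T j)); last 2 first.
- exact: ens_meas.
- apply: le_trans (potential_meas HT jS).
  rewrite cardsU1 jS natrD mulrDl mul1r addrC lerD //.
  rewrite ltW // real_ltNge ?ger0_real //; apply: sumr_ge0 => i /andP[iS ij].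
  exact: (incr_tot_ge0 HT).
- by rewrite cardsU1 jS add1n subnS -subn1 leq_subLR add1n.
Qed.

End Ensembles.

(** * States and their marginals *)

Section States.
Context {C : numClosedFieldType}.

Lemma entK (T : finType) (f : T -> T -> C) x y : ent (mkop f) x y = f x y.
Proof. by rewrite /ent /mkop mxE !enum_rankK. Qed.

Lemma sum_enum_val (V : nmodType) (T : finType) (F : 'I_#|T| -> V) :
  \sum_p F p = \sum_x F (enum_rank x).
Proof. by rewrite (reindex enum_rank) //; apply: onW_bij; apply: enum_rank_bij. Qed.

Lemma psdmx_entP (T : finType) (A : 'M[C]_#|T|) : psdmx A <-> psdk (ent A).
Proof.
rewrite psdmxP; split=> A0 u.
  have := A0 (u \o enum_val); rewrite sum_enum_val.
  congr (0 <= _); apply: eq_bigr => x _; rewrite sum_enum_val.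
  by apply: eq_bigr => y _ /=; rewrite !enum_rankK.
have := A0 (u \o enum_rank); congr (0 <= _); rewrite [RHS]sum_enum_val.
by apply: eq_bigr => x _; rewrite [RHS]sum_enum_val.
Qed.

(** Entries are paired without a transpose, so N k acts as the transpose of an observable; this
    preserves positivity. *)
Definition ctr n d (rho : qop C n d) (N : 'I_n -> @kern C d) : C :=
  \sum_(x : qbasis n d) \sum_(y : qbasis n d)
    ent rho x y * \prod_k N k (x k) (y k).

Lemma prod_upd n d (N : 'I_n -> @kern C d) k A (x y : 'I_n -> 'I_d) :
  \prod_l upd N k A l (x l) (y l) =
  A (x k) (y k) * \prod_(l | l != k) N l (x l) (y l).
Proof.
rewrite (bigD1 k) //= {1}/upd eqxx; congr (_ * _).
by apply: eq_bigr => l /negbTE lk; rewrite /upd lk.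
Qed.

Lemma sum_delk d (A : @kern C d) x y :
  \sum_a \sum_b A a b * delk a b x y = A x y.
Proof.
rewrite (bigD1 x) //= (bigD1 y) //= [in X in _ + X]big1 => [|a ax]; last first.
  by rewrite big1 // => b _; rewrite /delk [x == a]eq_sym (negbTE ax) mulr0.
rewrite [X in _ + X + _]big1 => [|b yb]; last first.
  by rewrite /delk [y == b]eq_sym (negbTE yb) andbF mulr0.
by rewrite /delk !eqxx mulr1 !addr0.
Qed.

(** For positivity, write each N k as a Gram kernel: the product over the sites expands over strings
    f into rank-one kernels, on which the contraction is the quadratic form of rho. *)
Lemma ctr_pfun n d (rho : qop C n d) : psdmx rho -> pfun finset.set0 (ctr rho).
Proof.
move=> /psdmx_entP rho0; split.
  move=> k N A _; rewrite /ctr.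
  under [RHS]eq_bigr do under eq_bigr do rewrite mulr_sumr.
  under [RHS]eq_bigr do rewrite exchange_big /=.
  rewrite [RHS]exchange_big; apply: eq_bigr => x _ /=.
  under [RHS]eq_bigr do under eq_bigr do rewrite mulr_sumr.
  under [RHS]eq_bigr do rewrite exchange_big /=.
  rewrite [RHS]exchange_big; apply: eq_bigr => y _ /=.
  rewrite prod_upd -(sum_delk A (x k) (y k)) mulr_suml mulr_sumr.
  apply: eq_bigr => a _; rewrite mulr_suml mulr_sumr; apply: eq_bigr => b _.
  by rewrite prod_upd; ring.
move=> N N0.
have /choice[g gE] : forall k, exists g : 'I_d -> 'I_d -> C,
    forall a b, N k a b = \sum_s g s a * (g s b)^*.
  by move=> k; apply: psdk_gram.
have prodE (x y : qbasis n d) : \prod_k N k (x k) (y k) =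
    \sum_(f : {ffun 'I_n -> 'I_d})
      (\prod_k g k (f k) (x k)) * (\prod_k g k (f k) (y k))^*.
  under eq_bigr do rewrite gE.
  rewrite bigA_distr_bigA; apply: eq_bigr => f _.
  by rewrite rmorph_prod -big_split.
rewrite /ctr; under eq_bigr do under eq_bigr do rewrite prodE mulr_sumr.
under eq_bigr do rewrite exchange_big /=.
rewrite exchange_big; apply: sumr_ge0 => f _ /=; exact: rho0.
Qed.

Lemma ctr_tensorn n d (s : 'I_n -> 'M[C]_d) (N : 'I_n -> @kern C d) :
  ctr (tensorn s) N = \prod_k \sum_a \sum_b s k a b * N k a b.
Proof.
rewrite /ctr bigA_distr_bigA; apply: eq_bigr => x _ /=.
rewrite bigA_distr_bigA; apply: eq_bigr => y _ /=.
by rewrite /tensorn entK -big_split.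
Qed.

Lemma ctr_sum n d (Z : finType) (p : Z -> C) (r : Z -> qop C n d) N :
  ctr (\sum_z p z *: r z) N = \sum_z p z * ctr (r z) N.
Proof.
rewrite /ctr; under [RHS]eq_bigr do rewrite mulr_sumr.
rewrite [RHS]exchange_big; apply: eq_bigr => x _ /=.
under [RHS]eq_bigr do rewrite mulr_sumr.
rewrite [RHS]exchange_big; apply: eq_bigr => y _ /=.
rewrite /ent summxE mulr_suml; apply: eq_bigr => z _.
by rewrite mxE mulrA.
Qed.

Lemma prod_bool (I : finType) (P b : pred I) :
  \prod_(i | P i) (b i)%:R = [forall i, P i ==> b i]%:R :> C.
Proof.
case: (pickP (fun i => P i && ~~ b i)) => [i /andP[Pi /negbTE bi]|h].
  rewrite (bigD1 i) //= bi mul0r; case: forallP => [/(_ i)|//].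
  by rewrite Pi bi.
rewrite big1 => [|i Pi]; last by have := h i; rewrite Pi => /negbFE ->.
case: forallP => [//|[]] i; apply/implyP => Pi.
by have := h i; rewrite Pi => /negbFE ->.
Qed.

Lemma mass_ctr n d (rho : qop C n d) : mass (ctr rho) = \tr rho.
Proof.
rewrite /mass /ctr /mxtrace sum_enum_val; apply: eq_bigr => x _.
rewrite (bigD1 x) //= /ones /idk prod_bool big1 => [|y yx]; last first.
  rewrite prod_bool; case: forallP => [h|_]; last by rewrite mulr0.
  case/eqP: yx; apply/ffunP => k; apply/esym/eqP.
  exact: (h k).
rewrite addr0; case: forallP => [_|h]; first by rewrite mulr1n mulr1.
by case: h => k; rewrite /= eqxx.
Qed.

Lemma ptrace2E n d (rho : qop C n d) i j a b a' b' : i != j ->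
  ent (ptrace2 i j rho) (a, b) (a', b') = red2 (ctr rho) i j a a' b b'.
Proof.
move=> ij; rewrite /ptrace2 entK /red2 /ctr /= big_mkcond /=.
apply: eq_bigr => x _.
case: ifP => [/andP[/eqP xi /eqP xj]|/negbT xij]; last first.
  rewrite big1 // => y _; rewrite prod_upd (bigD1 i) //= {1}/upd eqxx /delk.
  by case/nandP: xij => /negbTE ->; rewrite ?mul0r ?mulr0.
rewrite big_mkcond; apply: eq_bigr => y _.
rewrite prod_upd (bigD1 i) //= {1}/upd eqxx /delk xi xj !eqxx /=.
rewrite (eq_bigr (fun k => (x k == y k)%:R)); last first.
  by move=> k /andP[_ /negbTE ki]; rewrite /upd ki.
rewrite prod_bool.
case: eqP => _ /=; last by rewrite mul0r mulr0 mulr0.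
case: eqP => _ /=; last by rewrite mul0r mulr0.
rewrite !mul1r; under [in RHS]eq_forallb do rewrite andbC.
by case: ifP => _; rewrite ?mulr1n ?mulr1 ?mulr0n ?mulr0.
Qed.

(** The form at u is the contraction of the rank-one operator of u with the s k, so [ctr_pfun]
    applies with the roles exchanged. *)
Lemma psdmx_tensorn n d (s : 'I_n -> 'M[C]_d) :
  (forall k, psdmx (s k)) -> psdmx (tensorn s).
Proof.
move=> s0; apply/psdmx_entP => u.
have u0 : psdmx (mkop (fun x y : qbasis n d => u x * (u y)^*)).
  apply/psdmx_entP => t.
  rewrite [X in 0 <= X](_ : _ = `|\sum_x u x * t x| ^+ 2) ?exprn_ge0 //.
  rewrite normCK rmorph_sum mulr_suml; apply: eq_bigr => x _.
  rewrite mulr_sumr; apply: eq_bigr => y _; rewrite entK rmorphM /=; ring.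
have sk k : psdk (fun a b => s k a b) by apply/psdmxP.
have := pfun_ge0 (ctr_pfun u0) sk; congr (0 <= _).
apply: eq_bigr => x _; apply: eq_bigr => y _.
by rewrite /tensorn !entK mulrC.
Qed.

Lemma density_mix n d (Z : finType) (p : Z -> C) (s : Z -> 'I_n -> 'M[C]_d) :
  (forall z, 0 <= p z) -> \sum_z p z = 1 ->
  (forall z k, density (s z k)) -> density (\sum_z p z *: tensorn (s z)).
Proof.
move=> p0 p1 sd; split; last first.
  rewrite -mass_ctr /mass ctr_sum -[RHS]p1; apply: eq_bigr => z _.
  rewrite ctr_tensorn big1 ?mulr1 // => k _; rewrite -[RHS](proj2 (sd z k)).
  rewrite /mxtrace -(sum_idk (fun a b => s z k a b)).
  by apply: eq_bigr => a _; apply: eq_bigr => b _; rewrite mulrC.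
apply/psdmx_entP => u.
rewrite [X in 0 <= X](_ : _ = \sum_z p z *
    \sum_x \sum_y ent (tensorn (s z)) x y * (u x * (u y)^*)).
  apply: sumr_ge0 => z _; rewrite mulr_ge0 //.
  by apply/psdmx_entP : u; apply: psdmx_tensorn => k; case: (sd z k).
under [RHS]eq_bigr do rewrite mulr_sumr.
rewrite [RHS]exchange_big; apply: eq_bigr => x _ /=.
under [RHS]eq_bigr do rewrite mulr_sumr.
rewrite [RHS]exchange_big; apply: eq_bigr => y _ /=.
rewrite /ent summxE mulr_suml; apply: eq_bigr => z _.
by rewrite mxE -!mulrA.
Qed.

(** Convexity of the squared modulus; the gap is a variance. *)
Lemma nrm2_sum_le (Z : finType) (p a : Z -> C) :
  (forall z, 0 <= p z) -> (forall z, p z = 0 -> a z = 0) -> \sum_z p z = 1 ->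
  `|\sum_z a z| ^+ 2 <= \sum_z `|a z| ^+ 2 / p z.
Proof.
move=> p0 pa p1; rewrite -subr_ge0.
have := variance_id p0 pa; rewrite p1 divr1 => ->.
by apply: sumr_ge0 => z _; rewrite divr_ge0 // exprn_ge0.
Qed.

Lemma density_pure d (a0 : 'I_d) :
  density (\matrix_(a, b) @rank1 C d (fun x => (x == a0)%:R) a b).
Proof.
split.
  apply/psdmxP => u; under eq_bigr do under eq_bigr do rewrite mxE.
  exact: psdk_rank1.
rewrite /mxtrace (bigD1 a0) //= mxE /rank1 eqxx mulr1n rmorph1 mulr1 big1 ?addr0 //.
by move=> a /negbTE aa; rewrite mxE aa mul0r.
Qed.

(** I i j is the purity gain of i when j is measured. For unmeasured i and j the error is the sum of
    [corr] over the outcomes, which convexity and [corr_incr] bound by the gain; the stopping rule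
    bounds the sums of I over i. *)
Lemma product_approx n d (rho : qop C n d) (eps : C) :
  (0 < d)%N -> density rho -> 0 <= eps ->
  exists (S : {set 'I_n}) (Z : finType) (p : Z -> C)
    (s : Z -> 'I_n -> 'M[C]_d) (I : 'I_n -> 'I_n -> C),
  [/\ #|S|%:R * eps <= n%:R,
      [/\ forall z, 0 <= p z, \sum_z p z = 1 & forall z k, density (s z k)],
      forall i j, 0 <= I i j,
      forall j, \sum_i I i j <= eps &
      forall i j, i != j -> i \notin S -> j \notin S ->
        nrm2 (fun x y => (ptrace2 i j rho
          - ptrace2 i j (\sum_z p z *: tensorn (s z))) x y) <= 4 * I i j].
Proof.
move=> d0 [rho0 rho1] eps0.
have [W [w [v dsg]]] := @design_exists C d.
have T01 : ctr rho (@ones C n d) = 1 by rewrite -/(mass _) mass_ctr.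
have [S [Z [T [HT Sn gain]]]] :=
  greedy_measurement dsg T01 eps0 (ctr_pfun rho0).
pose p z := mass (T z).
have p0 z : 0 <= p z := mass_ge0 (ens_pfun HT z).
have p1 : \sum_z p z = 1 := ens_mass T01 HT.
(* A fixed pure state is the default at measured sites and for outcomes of probability zero. *)
pose s z k : 'M[C]_d := if (k \in S) || (p z == 0)
  then \matrix_(a, b) rank1 (fun x => (x == Ordinal d0)%:R) a b
  else \matrix_(a, b) (red (T z) k a b / p z).
have sd z k : density (s z k).
  rewrite /s; case: ifP => [_|/negbT]; first exact: density_pure.
  rewrite negb_or => /andP[kS pz]; split.
    apply/psdmxP => u; under eq_bigr do under eq_bigr do rewrite mxE mulrAC.
    under eq_bigr do rewrite -mulr_suml.
    rewrite -mulr_suml divr_ge0 //.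
    exact: (psdk_red (ens_pfun HT z)).
  rewrite /mxtrace; under eq_bigr do rewrite mxE.
  by rewrite -mulr_suml (tr_red (ens_pfun HT z)) // divff.
pose I i j := if [&& i \notin S, j \notin S & i != j]
  then incr_tot w v T j i else 0.
have I0 i j : 0 <= I i j.
  rewrite /I; case: ifP => // /and3P[iS jS ij].
  exact: (incr_tot_ge0 dsg HT).
exists S, Z, p, s, I; split=> //.
  move=> j; rewrite /I; case: (boolP (j \in S)) => jS /=.
    by under eq_bigr do rewrite andbF; rewrite big1_eq.
  by rewrite -big_mkcond /=; apply: gain.
move=> i j ij iS jS; rewrite /I iS jS ij /= /nrm2 sum_enum_val.
under [leLHS]eq_bigr do rewrite sum_enum_val.
pose c z a b x y := corr (T z) i j a b x y.
have entE (ab xy : 'I_d * 'I_d) :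
  (ptrace2 i j rho - ptrace2 i j (\sum_z p z *: tensorn (s z)))
    (enum_rank ab) (enum_rank xy) = \sum_z c z ab.1 xy.1 ab.2 xy.2.
  case: ab xy => [a b] [x y]; rewrite mxE [X in _ + X]mxE -!/(ent _ _ _) !ptrace2E //=.
  (* As i and j are unmeasured, the argument is the identity on S and the outcomes add up to the
     full state. *)
  rewrite {1}/red2 -(ens_sum HT); last first.
    move=> k kS; have kj : k != j by apply: contraNneq jS => <-.
    have ki : k != i by apply: contraNneq iS => <-.
    by rewrite /upd (negbTE kj) (negbTE ki).
  rewrite {1}/red2 ctr_sum -sumrB; apply: eq_bigr => z _.
  rewrite /c /corr ctr_tensorn; congr (_ - _).
  rewrite (bigD1 j) //= (bigD1 i) //= [X in _ * (_ * X)]big1 ?mulr1 => [|k];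
    last first.
    move=> /andP[/negbTE kj /negbTE ki]; rewrite -[RHS](proj2 (sd z k)).
    rewrite /mxtrace -(sum_idk (fun a b => s z k a b)).
    apply: eq_bigr => t _; apply: eq_bigr => t' _.
    by rewrite /upd kj ki mulrC.
  have pick (A : 'M[C]_d) (t t' : 'I_d) :
      \sum_k \sum_l A k l * @delk C d t t' k l = A t t'.
    rewrite -(sum_delk (fun a b => A a b) t t').
    apply: eq_bigr => k _; apply: eq_bigr => l _.
    by rewrite /delk ![_ == t]eq_sym ![_ == t']eq_sym.
  rewrite /upd eqxx (negbTE ij) eqxx !pick /s (negbTE iS) (negbTE jS) /=.
  rewrite -/(p z); have [->|pz] := eqVneq (p z) 0.
    by rewrite invr0 mulr0 mulr0 mul0r.
  by rewrite !mxE; field.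
apply: le_trans (_ : \sum_(ab : 'I_d * 'I_d) \sum_(xy : 'I_d * 'I_d)
   \sum_z `|c z ab.1 xy.1 ab.2 xy.2| ^+ 2 / p z <= _).
  apply: ler_sum => ab _; apply: ler_sum => xy _.
  rewrite entE; apply: nrm2_sum_le => // z pz.
  exact: (mass0_corr (ens_pfun HT z) dsg).
rewrite /incr_tot mulr_sumr.
apply: le_trans (_ : \sum_z (\sum_a \sum_b nrm2 (corr (T z) i j a b)) / p z <= _);
  last first.
  by apply: ler_sum => z _; apply: (corr_incr (ens_pfun HT z) dsg).
rewrite le_eqVlt; apply/orP; left; apply/eqP.
under eq_bigr do rewrite exchange_big /=.
rewrite exchange_big; apply: eq_bigr => z _ /=.
under eq_bigr do rewrite -mulr_suml.
rewrite -mulr_suml; congr (_ / _).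
rewrite -(pair_bigA _ (fun a b => \sum_(xy : 'I_d * 'I_d) `|c z a xy.1 b xy.2| ^+ 2)) /=.
apply: eq_bigr => a _.
under eq_bigr do rewrite -(pair_bigA _ (fun x y => `|c z a x _ y| ^+ 2)) /=.
by rewrite exchange_big; apply: eq_bigr => x _.
Qed.

End States.

(** * The trace norm *)

Section TraceNorm.
Context {C : numClosedFieldType}.

Definition tnorm q (X : 'M[C]_q) : C := \tr (sqrtmx (adjmx X *m X)).

Lemma psd_tr_conj q m (A : 'M[C]_q) (M : 'M[C]_(m, q)) :
  psdmx A -> 0 <= \tr (M *m A *m adjmx M).
Proof.
move=> [_ A0]; apply: sumr_ge0 => k _.
have := A0 (row k M); congr (0 <= _).
rewrite -row_mul !mxE; apply: eq_bigr => a _.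
by rewrite !mxE.
Qed.

Lemma psdmx_gramian q (X : 'M[C]_q) : psdmx (adjmx X *m X).
Proof.
split; first by rewrite adjmxM adjmxK.
move=> v; have -> : v *m (adjmx X *m X) *m adjmx v =
  (v *m adjmx X) *m adjmx (v *m adjmx X) by rewrite adjmxM adjmxK !mulmxA.
by rewrite mxE; apply: sumr_ge0 => a _; rewrite adjmxE mul_conjC_ge0.
Qed.

Lemma tnormE q (X : 'M[C]_q) :
  tnorm X = \sum_s sqrtC (spectral_diag (adjmx X *m X) 0 s).
Proof.
rewrite /tnorm /sqrtmx mxtrace_mulC mulmxA mulmxV ?spectral_unit // mul1mx.
by rewrite mxtrace_diag; apply: eq_bigr => s _; rewrite mxE.
Qed.

Lemma tnorm_ge0 q (X : 'M[C]_q) : 0 <= tnorm X.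
Proof.
have [_ _ _ l0] := psdmx_spectral (psdmx_gramian X).
by rewrite tnormE; apply: sumr_ge0 => s _; rewrite sqrtC_ge0.
Qed.

(** Cauchy-Schwarz over the q singular values, read off from [variance_id] with unit weights. *)
Lemma tnorm_sqr_le q (X : 'M[C]_q) :
  tnorm X ^+ 2 <= q%:R * nrm2 (fun a b => X a b).
Proof.
have [PP _ eA l0] := psdmx_spectral (psdmx_gramian X).
set P := spectralmx _ in PP eA; set l := spectral_diag _ in eA l0.
have -> : nrm2 (fun a b => X a b) = \sum_s l 0 s.
  rewrite -sqr_nrm_tr mxtrace_mulC eA mxtrace_mulC mulmxA PP mul1mx.
  exact: mxtrace_diag.
have sq s : sqrtC (l 0 s) ^+ 2 = l 0 s by rewrite sqrtCK.
rewrite tnormE -/l.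
have n10 s : 1 = 0 :> C -> sqrtC (l 0 s) = 0.
  by move/eqP; rewrite oner_eq0.
have := variance_id (fun=> ler01) n10.
set V := (X in _ = X); have V0 : 0 <= V.
  by apply: sumr_ge0 => s _; rewrite divr1 exprn_ge0.
move: V0 => /[swap] <-; rewrite sumr_const cardT size_enum_ord.
under eq_bigr do rewrite divr1 ger0_norm ?sqrtC_ge0 // sq.
rewrite ger0_norm; last by apply: sumr_ge0 => s _; rewrite sqrtC_ge0.
case: (posnP q) => [q0 _|qp].
  have E (F : 'I_q -> C) : \sum_s F s = 0.
    apply: big1 => s _; suff: false by [].
    by have := ltn_ord s; rewrite [X in (_ < X)%N]q0.
  by rewrite !E expr0n mulr0.
by rewrite subr_ge0 ler_pdivrMr ?ltr0n // mulrC.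
Qed.

(* With X = U |X| the polar decomposition, P the eigenbasis of |X| and G = P U',
   one has tr |X| = tr (G X P'), where ' is the adjoint; positivity of
   (G + c P) rho (G + c P)' for c = 1, -1 bounds the cross terms. *)
Lemma tnorm_density_sub q (rho sigma : 'M[C]_q) :
  density rho -> density sigma -> tnorm (rho - sigma) <= 2.
Proof.
move=> [rho0 rho1] [sig0 sig1]; set X := rho - sigma.
have [PP P'P eA l0] := psdmx_spectral (psdmx_gramian X).
have tE := tnormE X.
set P := spectralmx _ in PP P'P eA; set l := spectral_diag _ in eA l0 tE.
(* A zero singular value has inverse 0 here, so G is a partial isometry. *)
pose h := diag_mx (\row_s (sqrtC (l 0 s))^-1).
pose G := h *m P *m adjmx X.
have hE : adjmx h = h.
  apply/matrixP => a b; rewrite adjmxE !mxE.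
  have [->|_] := eqVneq a b; last by rewrite !mulr0n rmorph0.
  by rewrite !mulr1n conj_Creal // ger0_real // invr_ge0 sqrtC_ge0.
have PAP : P *m (adjmx X *m X) *m adjmx P = diag_mx l.
  by rewrite eA !mulmxA PP mul1mx -mulmxA PP mulmx1.
have GX : \tr (G *m X *m adjmx P) = tnorm X.
  rewrite (_ : G *m X *m adjmx P = h *m diag_mx l); last first.
    by rewrite -PAP /G !mulmxA.
  rewrite mulmx_diag mxtrace_diag tE; apply: eq_bigr => s _; rewrite !mxE.
  have [z|z] := eqVneq (sqrtC (l 0 s)) 0.
    by rewrite z invr0 mul0r.
  by rewrite -{2}(sqrtCK (l 0 s)) expr2 mulrA mulVf // mul1r.
have GG : G *m adjmx G *m G = G.
  have -> : G *m adjmx G = h *m diag_mx l *m h.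
    by rewrite -PAP /G !adjmxM adjmxK hE !mulmxA.
  rewrite {1}/G !mulmxA; congr (_ *m _ *m _).
  rewrite !mulmx_diag; congr diag_mx; apply/rowP => s; rewrite !mxE.
  have [z|z] := eqVneq (sqrtC (l 0 s)) 0; first by rewrite z invr0 mulr0.
  by move: (sqrtCK (l 0 s)) z; move: (sqrtC _) => r <- rN; field.
clearbody G.
(* Each trace is at most tr tau = 1, since P is unitary and the adjoint of G times G is a
   projection. *)
have bound (tau : 'M[C]_q) : density tau ->
    \tr (G *m tau *m adjmx G) + \tr (P *m tau *m adjmx P) <= 2.
  move=> [t0 t1]; rewrite [X in _ + X]mxtrace_mulC mulmxA P'P mul1mx t1.
  have -> : (2 : C) = 1 + 1 by [].
  rewrite lerD2r; pose Q := 1%:M - adjmx G *m G.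
  have := psd_tr_conj Q t0.
  have QQ : adjmx Q *m Q = Q.
    have -> : adjmx Q = Q.
      rewrite /Q adjmxD adjmxN adjmxM adjmxK; congr (_ - _).
      apply/matrixP => a b; rewrite adjmxE !mxE eq_sym.
      by case: (_ == _); rewrite ?rmorph1 ?rmorph0.
    rewrite /Q mulmxBl mul1mx mulmxBr mulmx1 !mulmxA.
    have -> : adjmx G *m G *m adjmx G *m G = adjmx G *m G.
      by rewrite -!mulmxA (mulmxA G (adjmx G) G) GG.
    by rewrite subrr subr0.
  rewrite mxtrace_mulC mulmxA QQ /Q mulmxBl mul1mx raddfB /= t1 subr_ge0.
  by rewrite [\tr (G *m tau *m _)]mxtrace_mulC mulmxA.
have cross (tau : 'M[C]_q) (c : C) : c^* = c -> c ^+ 2 = 1 -> density tau ->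
    - c * (\tr (G *m tau *m adjmx P) + \tr (P *m tau *m adjmx G)) <= 2.
  move=> cc c2 dt; apply: le_trans (bound _ dt).
  have := psd_tr_conj (G + c *: P) (proj1 dt).
  rewrite adjmxD (_ : adjmx (c *: P) = c *: adjmx P); last first.
    by apply/matrixP => a b; rewrite !mxE rmorphM /= cc.
  rewrite !(mulmxDl, mulmxDr) -!(scalemxAl, scalemxAr) -?scalemxAl.
  rewrite !raddfD /= !mxtraceZ mulrA -expr2 c2 mul1r -subr_ge0 => H.
  rewrite -subr_ge0; move: H; rewrite subr0; congr (0 <= _); ring.
have tr_conj (A : 'M[C]_q) : \tr (adjmx A) = (\tr A)^*.
  by rewrite /mxtrace rmorph_sum; apply: eq_bigr => s _; rewrite adjmxE.
have hX : adjmx X = X.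
  by rewrite /X adjmxD adjmxN -(proj1 rho0) -(proj1 sig0).
have t2 : 2 * tnorm X =
    \tr (G *m X *m adjmx P) + \tr (P *m X *m adjmx G).
  rewrite GX (_ : P *m X *m adjmx G = adjmx (G *m X *m adjmx P)); last first.
    by rewrite !adjmxM adjmxK hX mulmxA.
  rewrite tr_conj GX conj_Creal ?ger0_real ?tnorm_ge0 //; ring.
have e1 := cross rho (-1) _ _ (conj rho0 rho1).
have e2 := cross sigma 1 _ _ (conj sig0 sig1).
rewrite -(ler_pM2l (x := 2)) ?ltr0n // t2.
have -> : (2 * 2 : C) = 2 + 2 by ring.
apply: le_trans (lerD (e1 _ _) (e2 _ _)).
- rewrite /X !mulmxBr !mulmxBl !raddfB /= le_eqVlt; apply/orP; left.
  by apply/eqP; ring.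
- by rewrite rmorphN1.
- by rewrite sqrrN expr1n.
- by rewrite rmorph1.
- by rewrite expr1n.
Qed.

End TraceNorm.

(** * Marginals on pairs and averages over edges *)

Section Marginals.
Context {C : numClosedFieldType}.
Variables (n d : nat) (rho : qop C n d) (i j : 'I_n).

(** The string with sites i and j erased: the partial trace keeps the pairs of strings with equal
    masks. *)
Definition mask (x : qbasis n d) : {ffun 'I_n -> option 'I_d} :=
  [ffun k => if (k == i) || (k == j) then None else Some (x k)].

Lemma mask_eq x y : (mask x == mask y) =
  [forall k, (k != i) && (k != j) ==> (x k == y k)].
Proof.
apply/eqP/forallP => [xy k|xy].
  have /ffunP/(_ k) := xy; rewrite !ffunE -negb_or.
  by case: ifP => //= _ [->].
apply/ffunP => k; rewrite !ffunE; have := xy k; rewrite -negb_or.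
by case: ifP => //= _ /eqP ->.
Qed.

Lemma ptrace2_pairing (F : 'I_d * 'I_d -> 'I_d * 'I_d -> C) :
  \sum_t \sum_t' ent (ptrace2 i j rho) t t' * F t t' =
  \sum_x \sum_y (mask x == mask y)%:R * ent rho x y
    * F (x i, x j) (y i, y j).
Proof.
rewrite [RHS](partition_big (fun x : qbasis n d => (x i, x j)) predT) //=.
apply: eq_bigr => -[a b] _.
under eq_bigr do rewrite entK /= mulr_suml.
rewrite exchange_big /=; apply: eq_big => [x|x /andP[/eqP xi /eqP xj]].
  by rewrite xpair_eqE.
rewrite xi xj.
rewrite [RHS](partition_big (fun y : qbasis n d => (y i, y j)) predT) //=.
apply: eq_bigr => -[a' b'] _; rewrite mulr_suml big_mkcond [RHS]big_mkcond /=.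
apply: eq_bigr => y _; rewrite mask_eq xpair_eqE.
case: eqP => [->|_] //=; case: eqP => [->|_] //=.
by case: ifP => _; rewrite ?mul1r ?mul0r.
Qed.

(** The form of the marginal at u is a sum, over the values g of the mask, of forms of rho at a copy
    of u supported on the strings with mask g. *)
Lemma psdmx_ptrace2 : psdmx rho -> psdmx (ptrace2 i j rho).
Proof.
move=> /psdmx_entP rho0; apply/psdmx_entP => u.
rewrite (ptrace2_pairing (fun t t' => u t * (u t')^*)).
pose ug g (x : qbasis n d) := (mask x == g)%:R * u (x i, x j).
rewrite [X in 0 <= X](_ : _ = \sum_g \sum_x \sum_y
    ent rho x y * (ug g x * (ug g y)^*)).
  by apply: sumr_ge0 => g _; apply: rho0.
rewrite [RHS]exchange_big; apply: eq_bigr => x _ /=.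
rewrite [RHS]exchange_big; apply: eq_bigr => y _ /=.
rewrite (bigD1 (mask x)) //= big1 => [|g /negbTE gx]; last first.
  by rewrite /ug eq_sym gx !mul0r mulr0.
rewrite addr0 /ug eqxx mul1r rmorphM [_ == mask x]eq_sym rmorph_nat.
by rewrite /=; ring.
Qed.

Lemma density_ptrace2 : i != j -> density rho -> density (ptrace2 i j rho).
Proof.
move=> ij [rho0 rho1]; split; first exact: psdmx_ptrace2.
have H := ctr_pfun rho0.
rewrite /mxtrace sum_enum_val -[RHS]rho1 -mass_ctr -(tr_red H (i := i)) ?inE //.
rewrite (eq_bigr (fun t => ent (ptrace2 i j rho) (t.1, t.2) (t.1, t.2)));
  last by case.
rewrite -(pair_bigA _ (fun a b => ent (ptrace2 i j rho) (a, b) (a, b))).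
apply: eq_bigr => a _ /=; rewrite -(tr2_red2 H (j := j)) ?inE //.
by apply: eq_bigr => b _; rewrite -ptrace2E.
Qed.

End Marginals.

(** * Assembling the edge bound *)

Section Final.
Context {R : realType}.

Lemma trnormE q (X : 'M[R[i]]_q) : (trnorm X)%:C%C = tnorm X.
Proof. by rewrite /trnorm RRe_real // ger0_real // tnorm_ge0. Qed.

(** From ln (1 + t) <= t at t = -1/2. The final estimate uses it as 1 <= 2 ln d. *)
Lemma ln_ge_half (d : nat) : (2 <= d)%N -> 2^-1 <= ln (d%:R : R).
Proof.
move=> d2; apply: (@le_trans _ _ (ln (2 : R))).
  have := @le_ln1Dx R (- 2^-1).
  have -> : 1 + - 2^-1 = 2^-1 :> R by field.
  rewrite lnV ?posrE // lerN2; apply.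
  by rewrite ltrN2 invf_lt1 // ltr1n.
by rewrite ler_ln ?posrE ?ltr0n ?ler_nat // (leq_trans _ d2).
Qed.

Lemma sum_edges_l n D (e : rel 'I_n) (F : 'I_n -> R) : regular_graph D e ->
  \sum_i \sum_(j | e i j) F i = D%:R * \sum_i F i.
Proof.
move=> [_ _ eD]; rewrite mulr_sumr; apply: eq_bigr => i _.
rewrite sumr_const mulr_natl -(eD i); congr (_ *+ _).
by apply: eq_card => j; rewrite !inE.
Qed.

Lemma sum_edges_r n D (e : rel 'I_n) (F : 'I_n -> R) : regular_graph D e ->
  \sum_i \sum_(j | e i j) F j = D%:R * \sum_i F i.
Proof.
move=> G; rewrite -(sum_edges_l F G) (exchange_big_dep predT) //=.
by case: G => eS _ _; apply: eq_bigr => i _; apply: eq_bigl => j; rewrite eS.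
Qed.

Lemma mix_separable n d (Z : finType) (p : Z -> R[i]) (s : Z -> 'I_n -> 'M[R[i]]_d) :
  (forall z, 0 <= p z) -> \sum_z p z = 1 ->
  (forall z k, density (s z k)) -> separable (\sum_z p z *: tensorn (s z)).
Proof.
move=> p0 p1 sd.
have pr z : (complex.Re (p z))%:C%C = p z by rewrite RRe_real // ger0_real.
exists #|Z|, (fun z => complex.Re (p (enum_val z))), (fun z => s (enum_val z)).
split=> //.
- by move=> z; rewrite -lecR pr.
- apply: complexI; rewrite rmorph_sum rmorph1 -p1 sum_enum_val.
  by apply: eq_bigr => z _; rewrite enum_rankK /= pr.
- rewrite [RHS]sum_enum_val; apply: eq_bigr => z _.
  by rewrite !enum_rankK pr.
Qed.

End Final.

Theorem theorem3 (R : realType) (d D n : nat) (e : rel 'I_n)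
    (rho : qop R[i] n d) :
  (2 <= d)%N -> (1 <= D)%N -> regular_graph D e -> density rho ->
  exists sigma : qop R[i] n d,
    [/\ density sigma, separable sigma &
      edge_avg D e (fun i j => trnorm (ptrace2 i j rho - ptrace2 i j sigma))
      <= 12 * ((d%:R ^+ 2 * ln (d%:R : R)) / D%:R) `^ (3%:R^-1)].
Proof.
move=> d2 D1 G rhod.
set x := _ `^ _.
have hl := ln_ge_half (R := R) d2; set l := ln _ in hl x *.
have d0 : (0 < d)%N by apply: leq_trans d2.
have dp : 0 < (d%:R : R) by rewrite ltr0n.
have Dp : 0 < (D%:R : R) by rewrite ltr0n.
have lp : 0 < l by apply: lt_le_trans hl; rewrite invr_gt0.
have ap : 0 < d%:R ^+ 2 * l / D%:R by rewrite divr_gt0 // mulr_gt0 // exprn_gt0.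
have xp : 0 < x by apply: powR_gt0.
have x3 : x ^+ 3 * D%:R = d%:R ^+ 2 * l.
  rewrite /x -powR_mulrn ?powR_ge0 // -powRrM mulVf ?pnatr_eq0 //.
  by rewrite powRr1 ?ltW // divfK // gt_eqF.
(* The threshold 1 / x lets at most n x sites be measured. *)
have eps0 : 0 <= (x^-1)%:C%C by rewrite lecR invr_ge0 ltW.
have [S [Z [p [s [I [Sn [p0 p1 sd] I0 Ieps good]]]]]] :=
  product_approx d0 rhod eps0.
set sigma := \sum_z _ in good.
have sigd : density sigma by apply: density_mix.
exists sigma; split=> //; first exact: mix_separable.
pose J i j := complex.Re (I i j).
have JE i j : (J i j)%:C%C = I i j by rewrite RRe_real // ger0_real.
have J0 i j : 0 <= J i j by rewrite -lecR JE.
have Jx j : \sum_i J i j <= x^-1.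
  by rewrite -lecR rmorph_sum /=; under eq_bigr do rewrite JE.
have Sx : #|S|%:R <= x * n%:R.
  by rewrite -ler_pdivrMl // mulrC -lecR rmorphM /= !rmorph_nat.
pose t i j := trnorm (ptrace2 i j rho - ptrace2 i j sigma).
have t2 i j : i != j -> t i j <= 2.
  move=> ij; rewrite -lecR trnormE rmorph_nat.
  by apply: tnorm_density_sub; apply: density_ptrace2.
have tg i j : i != j -> i \notin S -> j \notin S ->
    t i j <= 2 * x + d%:R ^+ 2 / (2 * x) * J i j.
  move=> ij iS jS.
  have q2 : #|{: 'I_d * 'I_d}|%:R = d%:R * d%:R :> R[i].
    by rewrite card_prod card_ord natrM.
  have h : t i j ^+ 2 <= d%:R ^+ 2 * (4 * J i j).
    rewrite -lecR expr2 rmorphM /= -expr2 trnormE (le_trans (tnorm_sqr_le _)) //.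
    rewrite expr2 !rmorphM /= !rmorph_nat JE q2.
    by rewrite ler_wpM2l ?mulr_ge0 ?ler0n // good.
  (* This is t <= 2 x + t^2 / (8 x), to be combined with t^2 <= 4 d^2 J. *)
  have sq : 0 <= (t i j - 4 * x) ^+ 2 by apply: sqr_ge0.
  rewrite -(ler_pM2r (x := 8 * x)) ?mulr_gt0 //.
  have -> : (2 * x + d%:R ^+ 2 / (2 * x) * J i j) * (8 * x) =
      16 * x ^+ 2 + d%:R ^+ 2 * (4 * J i j) by field; rewrite gt_eqF.
  nra.
pose c : R := d%:R ^+ 2 / (2 * x).
have c0 : 0 <= c by rewrite divr_ge0 ?exprn_ge0 ?ler0n // ltW // mulr_gt0.
have tb i j : e i j -> t i j <=
    2 * (i \in S)%:R + 2 * (j \in S)%:R + 2 * x + c * J i j.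
  move=> eij; have ij : i != j.
    by apply: contraTneq eij => ->; case: G => _ -> _.
  have cJ : 0 <= c * J i j by apply: mulr_ge0.
  have := t2 _ _ ij; have := tg _ _ ij; rewrite -/c.
  by case: (i \in S) => /=; case: (j \in S) => /=;
    rewrite ?mulr1n ?mulr0n => h1 h2; [lra|lra|lra|move: (h1 isT isT); lra].
(* 7 = 2 + 2 + 2 + 1: measured first endpoints, measured second endpoints, the constant 2 x, and the
   gains. *)
have total : \sum_i \sum_(j | e i j) t i j <= 7 * x * (n%:R * D%:R).
  apply: le_trans (_ : \sum_i \sum_(j | e i j)
    (2 * (i \in S)%:R + 2 * (j \in S)%:R + 2 * x + c * J i j) <= _).
    by apply: ler_sum => i _; apply: ler_sum => j; apply: tb.
  under eq_bigr do rewrite !big_split /=.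
  rewrite !big_split /= (sum_edges_l (fun i => 2 * (i \in S)%:R) G).
  rewrite (sum_edges_r (fun i => 2 * (i \in S)%:R) G).
  rewrite (sum_edges_l (fun=> 2 * x) G) sumr_const card_ord.
  have -> : \sum_(i < n) 2 * (i \in S)%:R = 2 * #|S|%:R :> R.
    rewrite -mulr_sumr -sum1_card natr_sum [in RHS]big_mkcond /=.
    by congr (_ * _); apply: eq_bigr => i _; case: (i \in S).
  (* As J is nonnegative, the sum may run over all ordered pairs; for each j the sum over i is at
     most 1 / x. *)
  have JJ : \sum_i \sum_(j | e i j) c * J i j <= c * (n%:R / x).
    apply: le_trans (_ : \sum_i \sum_j c * J i j <= _).
      apply: ler_sum => i _; rewrite big_mkcond; apply: ler_sum => j _.
      by case: ifP => // _; apply: mulr_ge0.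
    rewrite exchange_big /=; under eq_bigr do rewrite -mulr_sumr.
    rewrite -mulr_sumr ler_wpM2l //.
    apply: le_trans (ler_sum _ (fun j _ => Jx j)) _.
    by rewrite sumr_const card_ord mulr_natl.
  (* Up to the factor n this is d^2 <= 2 x^3 D = 2 d^2 ln d. *)
  have cx : c * (n%:R / x) <= x * (n%:R * D%:R).
    rewrite /c -(ler_pM2r (x := 2 * x ^+ 2)) ?mulr_gt0 ?exprn_gt0 //.
    have -> : d%:R ^+ 2 / (2 * x) * (n%:R / x) * (2 * x ^+ 2) =
      d%:R ^+ 2 * n%:R by field; rewrite gt_eqF.
    have -> : x * (n%:R * D%:R) * (2 * x ^+ 2) = 2 * n%:R * (x ^+ 3 * D%:R).
      by ring.
    rewrite x3 (_ : 2 * n%:R * _ = d%:R ^+ 2 * n%:R * (2 * l)); last by ring.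
    rewrite ler_peMr ?mulr_ge0 ?exprn_ge0 ?ler0n //.
    by move: hl; lra.
  have DS : D%:R * (2 * #|S|%:R) <= 2 * (x * (n%:R * D%:R)).
    rewrite [leRHS](_ : _ = D%:R * (2 * (x * n%:R))); last by ring.
    by rewrite !ler_pM2l.
  rewrite -mulr_natl; lra.
rewrite /edge_avg natrM.
(* Without vertices the average is a division by zero, which returns 0. *)
have [nd0|ndN] := eqVneq (n%:R * D%:R : R) 0.
  by rewrite nd0 invr0 mulr0 mulr_ge0 // ltW.
have ndp : 0 < n%:R * D%:R :> R by rewrite lt_def ndN mulr_ge0.
rewrite ler_pdivrMr // (le_trans total) // ler_pM2r //.
by rewrite ler_pM2r // ler_nat.
Qed.
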